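(* Consider the following conditions on a torus with edge set, for a number $\beta>0$: $$\max_{x\in\mathbb T_{r,n}}D(x)\le\beta\qquad\text{and}\qquad \frac1V\sum_{k\in\mathbb T_{r,n}^*:\,k\ne0}\frac{\hat D(k)^2}{[1-\hat D(k)]^3}\le\beta.\qquad(\mathrm A_\beta)$$ 1. There is a universal constant $a>0$ such that for all $r\ge2$ and $n\ge7$ the nearest-neighbor torus satisfies $(\mathrm A_\beta)$ with $\beta=a\Omega^{-1}$. 2. There is a universal constant $a>0$ such that for all $r\ge2$ and $n\ge1$ the Hamming torus satisfies $(\mathrm A_\beta)$ with $\beta=a\Omega^{-1}$. 3. For each fixed $n\ge7$ there is a constant $a>0$ depending on $n$ but not on $L$ or $r$ such that, for all $L$ sufficiently large (depending on $n$) and all $r$ sufficiently large depending on $L$ and $n$, the spread-out torus with range $L$ satisfies $(\mathrm A_\beta)$ with $\beta=a\Omega^{-1}$.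
   Context: $\mathbb T_{r,n}=(\mathbb Z/r\mathbb Z)^n$, $V=r^n$. Edge sets on the vertex set $\mathbb T_{r,n}$: (nearest-neighbor torus) an edge joins vertices that differ by $1$ modulo $r$ in exactly one component; (Hamming torus) an edge joins vertices that differ in exactly one component; (spread-out torus with range $L$) an edge joins $x$ and $y$ if $0<\max_i|x_i-y_i|\le L$, with $|\cdot|$ the metric on $\mathbb Z/r\mathbb Z$, and $r\ge 2L+1$. In each case $\Omega$ denotes the common vertex degree and $D(x)=\Omega^{-1}I[\{0,x\}\text{ is an edge}]$. The dual torus is $\mathbb T_{r,n}^*=\frac{2\pi}{r}\{-\lfloor\frac{r-1}2\rfloor,\dots,\lceil\frac{r-1}2\rceil\}^n$ and $\hat D(k)=\sum_{x\in\mathbb T_{r,n}}D(x)e^{ik\cdot x}$. *)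

(* Defs.v *)
From mathcomp Require Import all_boot all_order all_algebra.
From mathcomp Require Import complex.
From mathcomp Require Import reals trigo.

Set Implicit Arguments.
Unset Strict Implicit.
Unset Printing Implicit Defensive.

Import Order.TTheory GRing.Theory Num.Theory.
Local Open Scope ring_scope.
Local Open Scope complex_scope.

(* 'Z_r is Z/rZ only for 1 < r ('Z_0 and 'Z_1 are both Z/2Z). *)
Definition torus (r n : nat) := 'rV['Z_r]_n.

Definition nn_edge (r n : nat) : rel (torus r n) := fun x y =>
  [exists i : 'I_n,
     ((x 0 i - y 0 i == 1) || (y 0 i - x 0 i == 1)) &&
     [forall j : 'I_n, (j != i) ==> (x 0 j == y 0 j)]].

Definition hamming_edge (r n : nat) : rel (torus r n) := fun x y =>
  #|[set i : 'I_n | x 0 i != y 0 i]| == 1%N.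

(* The two differences have representatives d and r - d in {0, .., r - 1}
   (both 0 if a = b). *)
Definition Zr_dist (r : nat) (a b : 'Z_r) : nat :=
  minn (a - b)%R (b - a)%R.

Definition spread_out_edge (L r n : nat) : rel (torus r n) := fun x y =>
  (0 < \max_(i < n) Zr_dist (x 0 i)%R (y 0 i)%R <= L)%N.

(* The common degree is read off at the origin; see [degree_common] and the
   three invariance lemmas before it. *)
Definition degree (r n : nat) (e : rel (torus r n)) (x : torus r n) : nat :=
  #|[set y | e x y]|.

Definition Omega (r n : nat) (e : rel (torus r n)) : nat := degree e 0.

Definition translation_invariant (r n : nat) (e : rel (torus r n)) : Prop :=
  forall x y z : torus r n, e (x + z) (y + z) = e x y.

Lemma nn_edge_invariant (r n : nat) : translation_invariant (@nn_edge r n).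
Proof.
move=> x y z; apply: eq_existsb => i.
rewrite !mxE !opprD !(addrACA _ (z 0 i)) subrr !addr0.
by congr (_ && _); apply: eq_forallb => j; rewrite !mxE (inj_eq (addIr _)).
Qed.

Lemma hamming_edge_invariant (r n : nat) :
  translation_invariant (@hamming_edge r n).
Proof.
move=> x y z; congr (_ == _); apply: eq_card => i.
by rewrite !inE !mxE (inj_eq (addIr _)).
Qed.

Lemma spread_out_edge_invariant (L r n : nat) :
  translation_invariant (@spread_out_edge L r n).
Proof.
move=> x y z; rewrite /spread_out_edge.
rewrite [X in (0 < X <= L)%N]
  (eq_bigr (fun i => Zr_dist (x 0 i) (y 0 i))) // => i _.
by rewrite /Zr_dist !mxE !opprD !(addrACA _ (z 0 i)) subrr !addr0.
Qed.

Lemma degree_common (r n : nat) (e : rel (torus r n)) :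
  translation_invariant e -> forall x, degree e x = Omega e.
Proof.
move=> He x; rewrite /Omega /degree -[RHS](card_imset _ (addIr x)).
apply: eq_card => y; rewrite !inE; apply/idP/imsetP.
- move=> exy; exists (y - x); last by rewrite subrK.
  by rewrite inE -(He _ _ x) add0r subrK.
- by case=> z; rewrite inE => e0z ->; rewrite -{1}[x]add0r He.
Qed.

Definition step (R : realType) (r n : nat) (e : rel (torus r n))
    (x : torus r n) : R :=
  (Omega e)%:R^-1 * (e 0 x)%:R.

(* Each coordinate ranges over (2 pi / r) m with
   - floor((r - 1) / 2) <= m <= ceil((r - 1) / 2), where
   m = j - floor((r - 1) / 2) for 0 <= j < r; every point is listed once. *)
Definition dual_torus (R : realType) (r n : nat) : seq 'rV[R]_n :=
  [seq \row_i (2 * pi / r%:R * ((j i)%:R - (r.-1./2)%:R))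
     | j : {ffun 'I_n -> 'I_r}].

Definition expi (R : realType) (t : R) : R[i] := cos t +i* sin t.

(* Coordinates of x are represented in {0, .., r - 1}; for k in the dual torus
   expi (kdot k x) does not depend on this choice. *)
Definition kdot (R : realType) (r n : nat) (k : 'rV[R]_n) (x : torus r n) : R :=
  \sum_(i < n) k 0 i * (x 0 i : nat)%:R.

Definition step_hat (R : realType) (r n : nat) (e : rel (torus r n))
    (k : 'rV[R]_n) : R[i] :=
  \sum_(x : torus r n) (step R e x)%:C * expi (kdot k x).

(* The default value 0 of the maximum is harmless because step >= 0.
   In R[i], z <= b%:C means that z is real and at most b.  The convention
   0^-1 = 0 plays no role on a connected torus: there step_hat e k <> 1 for
   every k <> 0 in the dual torus. *)
Definition A_cond (R : realType) (r n : nat) (e : rel (torus r n)) (beta : R)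
    : Prop :=
  \big[Num.max/0]_(x : torus r n) step R e x <= beta /\
  ((r ^ n)%N%:R^-1 : R[i]) *
    \sum_(k <- dual_torus R r n | k != 0)
      step_hat e k ^+ 2 / (1 - step_hat e k) ^+ 3 <= beta%:C.

(* Main.v *)
(** Write A = 1 - D^.  By Parseval the average of D^^2 over the dual torus is
    1/Omega, so the points k where A is bounded below contribute O(1/Omega).

    Nearest-neighbor and Hamming tori: A >= c M / n, where M counts the
    coordinates of k that are bounded away from 0.  M is binomial(n, p) under
    the uniform measure on the dual torus, and (np - M)^2 dominates the
    indicator of M < np/2 times (np/2)^2; size-biasing three times converts
    E[(np - M)^2 / M^3; M >= 1] into a variance, of order (1 - p) / n^2.  This
    covers the Hamming torus, where 1 - p = 1/r and M = 0 only for k = 0.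

    For small k in the other two cases, A is bounded below by a multiple of the
    square of the sup norm s of r k / (2 pi), and one sums s^-6 over boxes: s^(n-1)
    points at distance s against s^-6 is where n >= 7 enters.  In the
    spread-out case the lower bound on A comes from the Dirichlet kernel. *)
Require Import Defs.
From mathcomp Require Import all_boot all_order all_algebra.
From mathcomp Require Import complex.
From mathcomp Require Import reals trigo.
From mathcomp Require Import zify ring lra.

Set Implicit Arguments.
Unset Strict Implicit.
Unset Printing Implicit Defensive.

Import Order.TTheory GRing.Theory Num.Theory.
Local Open Scope ring_scope.
Local Open Scope complex_scope.

(** * Trigonometry *)

Section Trigonometry.
Variable R : realType.
Implicit Types (x y t : R).

(** Discrete concavity: [sin((j+2)x) + sin(jx) = 2 sin((j+1)x) cos x <= 2 sin((j+1)x)]. Since the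
    sequence starts at 0, the ratio [sin(jx)/j] is nonincreasing while the angles stay in
    [0, pi]. *)
Lemma sin_muln_step (N j : nat) x : 0 <= x -> N%:R * x <= pi -> (j < N)%N ->
  j%:R * sin (j.+1%:R * x) <= j.+1%:R * sin (j%:R * x).
Proof.
move=> x0 Nx; elim: j => [|j IH] jN; first by rewrite !mul0r sin0 mulr0.
have {}IH := IH (ltnW jN).
have s0 : 0 <= sin (j.+1%:R * x).
  apply: sin_ge0_pi; rewrite mulr_ge0 //= (le_trans _ Nx) //.
  by rewrite ler_wpM2r // ler_nat ltnW.
have sumE : sin (j.+2%:R * x) + sin (j%:R * x) = 2 * (sin (j.+1%:R * x) * cos x).
  have -> : j.+2%:R * x = j.+1%:R * x + x by rewrite -[in LHS]natr1; ring.
  have -> : j%:R * x = j.+1%:R * x - x by rewrite -[in RHS]natr1; ring.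
  by rewrite sinD sinB; ring.
have cle : sin (j.+1%:R * x) * cos x <= sin (j.+1%:R * x).
  by rewrite ler_piMr // cos_le1.
move: IH; rewrite -!(natr1 j.+1) -!(natr1 j) => IH.
have j0 : 0 <= j%:R :> R by [].
move: sumE cle IH; rewrite -!(natr1 j.+1) -!(natr1 j).
set a := sin _; set b := sin _; set c := sin _ => sumE cle IH.
have -> : a = 2 * (c * cos x) - b by rewrite -sumE addrK.
nra.
Qed.

(** Jordan's inequality [sin y >= 2y/pi] at [y = j pi / (2r)], reached by following the
    nonincreasing ratio [sin(ix)/i] from [i = j] to [i = r], where the sine is 1. *)
Lemma jordan_nat (r j : nat) : (0 < r)%N -> (j <= r)%N ->
  j%:R <= r%:R * sin (j%:R * (pi / 2 / r%:R)) :> R.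
Proof.
move=> r0 jr; set x := pi / 2 / r%:R.
have rn0 : r%:R != 0 :> R by rewrite pnatr_eq0 -lt0n.
have rx : r%:R * x = pi / 2 by rewrite /x mulrC divfK.
have x0 : 0 <= x by rewrite !mulr_ge0 ?invr_ge0 // pi_ge0.
have rp : r%:R * x <= pi by rewrite rx; have := pi_ge0 R; lra.
suff H : forall i, (i <= r - j)%N ->
    j%:R * sin ((j + i)%:R * x) <= (j + i)%:R * sin (j%:R * x).
  by have := H _ (leqnn _); rewrite subnKC // rx sin_pihalf mulr1.
case: (posnP j) => [-> i _|j0]; first by rewrite !mul0r sin0 mulr0.
elim=> [|i IH] ir; first by rewrite addn0.
have {}IH := IH (ltnW ir).
have st : (j + i)%:R * sin ((j + i).+1%:R * x) <= (j + i).+1%:R * sin ((j + i)%:R * x).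
  by apply: (sin_muln_step x0 rp); lia.
have p0 : 0 < (j + i)%:R :> R by rewrite ltr0n addn_gt0 j0.
rewrite addnS -(ler_pM2l p0) mulrCA.
apply: le_trans (ler_wpM2l _ st) _; first exact: ler0n.
by rewrite mulrCA [leRHS]mulrCA; apply: ler_wpM2l IH; exact: ler0n.
Qed.

Lemma one_sub_cos_double x : 1 - cos (2 * x) = 2 * sin x ^+ 2.
Proof. by rewrite mulr_natl cos_mulr2n cos2sin2 -mulr_natl; ring. Qed.

(** [1 - cos(2y) = 2 sin^2 y] with [y = pi s / r], and Jordan's inequality at the index [2s] gives
    [sin y >= 2s/r]; hence the constant 8. *)
Lemma one_sub_cos_ge (r s : nat) : (0 < r)%N -> (2 * s <= r)%N ->
  8 * (s%:R / r%:R) ^+ 2 <= 1 - cos (2 * pi / r%:R * s%:R) :> R.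
Proof.
move=> r0 sr; have rp : 0 < r%:R :> R by rewrite ltr0n.
have -> : 2 * pi / r%:R * s%:R = 2 * ((2 * s)%:R * (pi / 2 / r%:R)) :> R.
  by rewrite natrM; field; rewrite gt_eqF.
rewrite one_sub_cos_double.
have := jordan_nat r0 sr; set y := sin _; rewrite mulrC -ler_pdivrMr // natrM => H.
have a0 : 0 <= s%:R / r%:R :> R by rewrite divr_ge0.
rewrite -mulrA in H; move: H a0; set z := _ / _ => H a0; nra.
Qed.

(** The closed form of the Dirichlet kernel, multiplied out by [sin t]; the product-to-sum formula
    makes the sum telescope. *)
Lemma dirichlet_kernel (L : nat) t :
  (1 + \sum_(i < L) 2 * cos (2 * t * i.+1%:R)) * sin t = sin (L.*2.+1%:R * t).
Proof.
elim: L => [|L IH]; first by rewrite big_ord0 addr0 !mul1r.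
rewrite big_ord_recr /= addrA mulrDl IH.
have -> : 2 * t * L.+1%:R = L.*2.+1%:R * t + t.
  by rewrite -[in LHS]natr1 -[in RHS]natr1 -muln2 natrM; ring.
have -> : L.+1.*2.+1%:R * t = (L.*2.+1%:R * t + t) + t.
  by rewrite doubleS -[in LHS]natr1 -[in LHS]natr1; ring.
set a := L.*2.+1%:R * t.
rewrite [sin (a + t + t)]sinD.
have {1}-> : a = (a + t) - t by ring.
by rewrite sinB; ring.
Qed.

Lemma expi0 : expi (0 : R) = 1.
Proof. by rewrite /expi cos0 sin0. Qed.

Lemma expiD x y : expi (x + y) = expi x * expi y.
Proof. by rewrite /expi cosD sinD; simpc; congr (_ +i* _); ring. Qed.

Lemma expi_sum (I : Type) (s : seq I) (P : pred I) (F : I -> R) :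
  expi (\sum_(i <- s | P i) F i) = \prod_(i <- s | P i) expi (F i).
Proof. by apply: (big_morph (@expi R) expiD expi0). Qed.

Lemma expi_pi2 : expi (2 * pi : R) = 1.
Proof. by rewrite /expi mulr_natl cos2pi sin2pi. Qed.

Lemma expiMn x n : expi (x * n%:R) = expi x ^+ n.
Proof.
elim: n => [|n IH]; first by rewrite mulr0 expi0 expr0.
by rewrite -natr1 mulrDr mulr1 expiD IH exprSr.
Qed.

Lemma expi_neq1 (r s : nat) : (0 < s < r)%N -> expi (2 * pi / r%:R * s%:R : R) != 1.
Proof.
case/andP=> s0 sr.
have rp : 0 < r%:R :> R by rewrite ltr0n (leq_ltn_trans _ sr).
have -> : 2 * pi / r%:R * s%:R = 2 * (pi * (s%:R / r%:R)) :> R by ring.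
have sp : 0 < sin (pi * (s%:R / r%:R) : R).
  apply: sin_gt0_pi; rewrite mulr_gt0 ?pi_gt0 ?divr_gt0 ?ltr0n ?(leq_ltn_trans _ sr) //=.
  by rewrite gtr_pMr ?pi_gt0 // ltr_pdivrMr // mul1r ltr_nat.
apply/negP => /eqP /(congr1 (@complex.Re R)) /= cos1.
have : 2 * sin (pi * (s%:R / r%:R)) ^+ 2 != 0 :> R.
  by rewrite mulf_neq0 ?expf_neq0 ?gt_eqF.
by rewrite -one_sub_cos_double cos1 subrr eqxx.
Qed.

End Trigonometry.

(** * Fourier analysis on the torus *)

Section Fourier.
Variables (R : realType) (r' n : nat).
(** The form [r'.+2] builds in r >= 2 and makes ['Z_r] convertible to ['I_r]. *)
Local Notation r := r'.+2.
Local Notation h := (r.-1./2).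
Implicit Types (e : rel (torus r n)) (f : {ffun 'I_n -> 'I_r}) (x y : torus r n).

Definition freq (j : 'I_r) : R := 2 * pi / r%:R * (j%:R - h%:R).

Definition dual_point f : 'rV[R]_n := \row_i freq (f i).

(* Up to sign, [freq j] is 2 pi / r times this number. *)
Definition mode (j : 'I_r) : nat := ((j - h) + (h - j))%N.

Lemma r_neq0 : r%:R != 0 :> R.
Proof. by rewrite pnatr_eq0. Qed.

Lemma mode_le j : (2 * mode j <= r)%N.
Proof. by rewrite /mode; have := ltn_ord j; lia. Qed.

Lemma cos_freqM j (a : nat) :
  cos (freq j * a%:R) = cos (2 * pi / r%:R * (mode j * a)%:R).
Proof.
rewrite /freq /mode natrM mulrA; case: (leqP h j) => hj.
- by rewrite (eqP hj) addn0 natrB.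
- rewrite (eqP (ltnW hj)) add0n natrB ?(ltnW hj) // -[LHS]cosN; congr cos; ring.
Qed.

Lemma expi_freq_r j : expi (freq j * r%:R) = 1.
Proof.
have -> : freq j * r%:R = 2 * pi * j%:R - 2 * pi * h%:R.
  by rewrite /freq; move: (r%:R : R) r_neq0 => q q0; field.
have E (m : nat) : expi (2 * pi * m%:R : R) = 1 by rewrite expiMn expi_pi2 expr1n.
by rewrite -[LHS]mulr1 -(E h) -expiD subrK E.
Qed.

(** A multiple of r contributes full turns, so reduction mod r in the sum of two torus points is
    invisible to the characters. *)
Lemma expi_freq_mod j (a : nat) : expi (freq j * (a %% r)%:R) = expi (freq j * a%:R).
Proof.
rewrite {2}(divn_eq a r) natrD natrM mulrDr expiD.
by rewrite [_ * r%:R]mulrC mulrA [expi (_ * _ * _)]expiMn expi_freq_r expr1n mul1r.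
Qed.

Lemma expi_kdot f x :
  expi (kdot (dual_point f) x) = \prod_i expi (freq (f i) * (x 0 i : nat)%:R).
Proof. by rewrite /kdot expi_sum; apply: eq_bigr => i _; rewrite mxE. Qed.

Lemma expi_kdotD f x y :
  expi (kdot (dual_point f) (x + y)) =
  expi (kdot (dual_point f) x) * expi (kdot (dual_point f) y).
Proof.
rewrite !expi_kdot -big_split; apply: eq_bigr => i _ /=.
by rewrite mxE expi_freq_mod natrD mulrDr expiD.
Qed.

Lemma kdot0 (k : 'rV[R]_n) : kdot k (0 : torus r n) = 0.
Proof. by rewrite /kdot big1 // => i _; rewrite mxE mulr0. Qed.

(** The representatives of [- x] are not the negatives of those of [x]; both sides are instead
    identified as the inverse of the character at [x]. *)
Lemma expi_kdotN f x : expi (kdot (dual_point f) (- x)) = expi (- kdot (dual_point f) x).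
Proof.
have E : expi (kdot (dual_point f) x) * expi (kdot (dual_point f) (- x)) = 1.
  by rewrite -expi_kdotD subrr kdot0 expi0.
rewrite -[LHS]mul1r -(expi0 R) -(addNr (kdot (dual_point f) x)) expiD.
by rewrite -mulrA E mulr1.
Qed.

(** A geometric sum of a nontrivial r-th root of unity; the shift by [h] in [freq] only adds a
    constant phase. *)
Lemma sum_expi_freq (a : nat) : (0 < a < r)%N ->
  \sum_(j : 'I_r) expi (freq j * a%:R) = 0.
Proof.
move=> ha; set w := expi (2 * pi / r%:R * a%:R : R).
have w1 : w != 1 by exact: expi_neq1.
have wr : w ^+ r = 1.
  rewrite -expiMn.
  have -> : 2 * pi / r%:R * a%:R * r%:R = 2 * pi * a%:R :> R.
    by move: (r%:R : R) r_neq0 => q q0; field.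
  by rewrite expiMn expi_pi2 expr1n.
rewrite (eq_bigr (fun j : 'I_r => expi (- (2 * pi / r%:R * a%:R * h%:R)) * w ^+ j)).
  rewrite -mulr_sumr; suff -> : \sum_(j < r) w ^+ j = 0 by rewrite mulr0.
  apply/eqP; rewrite -(inj_eq (mulfI (_ : w - 1 != 0))) ?subr_eq0 //.
  by rewrite -subrX1 wr subrr mulr0.
move=> j _; rewrite -expiMn -expiD; congr expi; rewrite /freq; ring.
Qed.

(** Orthogonality of characters: the sum factors over coordinates, and a nonzero coordinate of [x]
    yields a zero factor. *)
Lemma sum_expi_dual (x : torus r n) :
  \sum_f expi (kdot (dual_point f) x) = if x == 0 then (r ^ n)%:R else 0.
Proof.
under eq_bigr do rewrite expi_kdot.
rewrite -(bigA_distr_bigA (fun i j => expi (freq j * (x 0 i : nat)%:R))) /=.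
have [->|/eqP x0] := eqVneq x 0.
  rewrite (eq_bigr (fun=> r%:R)); first by rewrite prodr_const card_ord natrX.
  move=> i _; rewrite (eq_bigr (fun=> 1)) ?sumr_const ?card_ord // => j _.
  by rewrite mxE mulr0 expi0.
have [i xi] : exists i, x 0 i != 0.
  case: (pickP (fun i => x 0 i != 0)) => [i xi|xi]; first by exists i.
  by case: x0; apply/rowP => i; rewrite mxE; apply/eqP; have := xi i; case: eqP.
rewrite (bigD1 i) //= sum_expi_freq ?mul0r // ltn_ord andbT.
by rewrite lt0n.
Qed.

Lemma dual_point_eq0 f : (dual_point f == 0) = [forall i, mode (f i) == 0%N].
Proof.
apply/eqP/forallP => [H i|H]; last first.
  apply/rowP => i; rewrite !mxE /freq; have := H i; rewrite /mode => /eqP E.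
  have -> : f i = h :> nat by lia.
  by rewrite subrr mulr0.
have := congr1 (fun k : 'rV[R]_n => k 0 i) H; rewrite !mxE /freq => /eqP.
rewrite !mulf_eq0 invr_eq0 !pnatr_eq0 /= gt_eqF ?pi_gt0 //= subr_eq0 eqr_nat => /eqP.
by rewrite /mode; lia.
Qed.

(** The real value of [step_hat] at a dual point when the neighbors of 0 are symmetric under
    negation; the estimates then stay inside [R]. *)
Definition hat e f : R :=
  (Omega e)%:R^-1 * \sum_(x | e 0 x) cos (kdot (dual_point f) x).

Lemma card_edge e : #|[pred x | e 0 x]| = Omega e.
Proof. by rewrite /Omega /degree cardsE. Qed.

(** Adding the sum to its image under [x -> - x] cancels the sines. *)
Lemma step_hat_real e f : (forall x, e 0 (- x) = e 0 x) ->
  step_hat e (dual_point f) = (hat e f)%:C.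
Proof.
move=> sym.
have -> : step_hat e (dual_point f) =
    ((Omega e)%:R^-1)%:C * \sum_(x | e 0 x) expi (kdot (dual_point f) x).
  rewrite /step_hat [in RHS]big_mkcond mulr_sumr; apply: eq_bigr => x _.
  by rewrite /step; case: (e 0 x); rewrite ?mulr1 ?mulr0 ?mul0r.
rewrite /hat rmorphM; congr (_ * _).
have E : \sum_(x | e 0 x) expi (kdot (dual_point f) x) =
         \sum_(x | e 0 x) expi (- kdot (dual_point f) x).
  rewrite (reindex_inj oppr_inj) /=.
  by apply: eq_big => [x|x _]; rewrite ?sym ?expi_kdotN.
have S : (\sum_(x | e 0 x) expi (kdot (dual_point f) x)) *+ 2 =
   \sum_(x | e 0 x) ((cos (kdot (dual_point f) x))%:C *+ 2).
  rewrite mulr2n {1}E -big_split /= ; apply: eq_bigr => x _.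
  by rewrite /expi cosN sinN mulr2n; simpc; rewrite addNr.
move: S; rewrite sumrMnl -rmorph_sum => /eqP.
by rewrite eqr_pMn2r // => /eqP.
Qed.

Lemma parseval e : (forall x, e 0 (- x) = e 0 x) ->
  \sum_f hat e f ^+ 2 = (r ^ n)%:R / (Omega e)%:R.
Proof.
move=> sym; apply: (@complexI R).
rewrite rmorph_sum /=.
under eq_bigr => f _ do rewrite rmorphXn /= -step_hat_real // /step_hat expr2 big_distrlr /=.
rewrite exchange_big /=.
under eq_bigr do rewrite exchange_big /=.
have E x y : \sum_f ((step R e x)%:C * expi (kdot (dual_point f) x) *
   ((step R e y)%:C * expi (kdot (dual_point f) y))) =
   (step R e x)%:C * (step R e y)%:C * (if x + y == 0 then (r ^ n)%:R else 0).
  rewrite -sum_expi_dual mulr_sumr; apply: eq_bigr => f _.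
  by rewrite expi_kdotD; ring.
(* By orthogonality only [y = - x] survives, and the symmetry of [e] turns the product of steps into
   a square. *)
under eq_bigr => x _.
  under eq_bigr do rewrite E.
  rewrite (bigD1 (- x)) //= subrr eqxx big1; last first.
    by move=> y yx; rewrite addrC addr_eq0 (negbTE yx) mulr0.
  rewrite addr0; over.
rewrite -mulr_suml -(rmorph_nat (real_complex R)).
under eq_bigr do rewrite -rmorphM.
rewrite -rmorph_sum -rmorphM; congr (_%:C).
rewrite mulrC; congr (_ * _).
under eq_bigr do rewrite /step sym mulrACA -natrM mulnb andbb.
rewrite -mulr_sumr; have -> : \sum_x (e 0 x)%:R = (Omega e)%:R :> R.
  by rewrite -card_edge -sum1_card natr_sum [RHS]big_mkcond; apply: eq_bigr => x _; case: ifP;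
    rewrite inE => ->.
(* At degree 0 both sides vanish through the convention [0^-1 = 0]. *)
have [->|O0] := eqVneq (Omega e) 0%N; first by rewrite invr0 mulr0.
by rewrite mulfVK // pnatr_eq0.
Qed.

Lemma one_sub_hat e f : (0 < Omega e)%N ->
  1 - hat e f = (Omega e)%:R^-1 * \sum_(x | e 0 x) (1 - cos (kdot (dual_point f) x)).
Proof.
move=> O0; rewrite sumrB mulrBr; congr (_ - _).
by rewrite sumr_const card_edge mulVf // pnatr_eq0 -lt0n.
Qed.

Lemma hat_sqr_le1 e f : hat e f ^+ 2 <= 1.
Proof.
rewrite -(@ler_sqrt R) ?sqr_ge0 // sqrtr1 sqrtr_sqr /hat normrM ger0_norm ?invr_ge0 //.
have [->|O0] := eqVneq (Omega e) 0%N; first by rewrite invr0 mul0r.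
rewrite ler_pdivrMl ?ltr0n ?lt0n // mulr1 (le_trans (ler_norm_sum _ _ _)) //.
rewrite -card_edge -sumr_const; apply: ler_sum => x _; exact: cos_max.
Qed.

(** The bound on the maximum costs only [1 <= a], because D is at most 1/Omega. The complex sum
    becomes a real one indexed by [f], with k = 0 read as all modes being 0. *)
Lemma A_cond_real e (a : R) : (forall x, e 0 (- x) = e 0 x) -> 1 <= a ->
  \sum_(f : {ffun 'I_n -> 'I_r} | ~~ [forall i, mode (f i) == 0%N])
     hat e f ^+ 2 / (1 - hat e f) ^+ 3
     <= (r ^ n)%:R * (a / (Omega e)%:R) ->
  A_cond e (a * (Omega e)%:R^-1).
Proof.
move=> sym a1 H; have O0 : 0 <= (Omega e)%:R^-1 :> R by rewrite invr_ge0.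
split.
  apply: bigmax_le => [|x _]; first by rewrite mulr_ge0 // (le_trans ler01).
  rewrite /step mulrC ler_wpM2r //; case: (e 0 x) => //.
  exact: le_trans ler01 a1.
rewrite /dual_torus big_map big_enum_cond /=.
rewrite (eq_bigl (fun f => ~~ [forall i, mode (f i) == 0%N])); last first.
  by move=> f; rewrite -dual_point_eq0.
rewrite (eq_bigr (fun f => (hat e f ^+ 2 / (1 - hat e f) ^+ 3)%:C)); last first.
  move=> f _; rewrite -/(dual_point f) step_hat_real //.
  move: (hat e f) => u.
  by rewrite rmorphM fmorphV !rmorphXn rmorphB rmorph1.
rewrite -rmorph_sum -(rmorph_nat (real_complex R)) -fmorphV -rmorphM lecR.
by rewrite ler_pdivrMl // ltr0n expn_gt0.
Qed.

End Fourier.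

(** * Binomial moments and shell sums *)

Section BinomialSums.
Variable R : realType.
Implicit Types (b c : R) (psi : nat -> R).

(** An unnormalized expectation: [(b+c)^n] times the mean of [psi] under the binomial law with n
    trials and success probability [b/(b+c)]. The arguments [b], [c] will be cardinalities. *)
Definition binsum b c n psi : R :=
  \sum_(m < n.+1) 'C(n, m)%:R * b ^+ m * c ^+ (n - m) * psi m.

Lemma eq_binsum b c n psi1 psi2 :
  psi1 =1 psi2 -> binsum b c n psi1 = binsum b c n psi2.
Proof. by move=> E; apply: eq_bigr => m _; rewrite E. Qed.

Lemma le_binsum b c n psi1 psi2 : 0 <= b -> 0 <= c ->
  (forall m, psi1 m <= psi2 m) -> binsum b c n psi1 <= binsum b c n psi2.
Proof.
move=> b0 c0 E; apply: ler_sum => m _.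
by rewrite ler_wpM2l // !mulr_ge0 // exprn_ge0.
Qed.

Lemma binsumD b c n psi1 psi2 :
  binsum b c n (fun m => psi1 m + psi2 m) = binsum b c n psi1 + binsum b c n psi2.
Proof. by rewrite -big_split; apply: eq_bigr => m _; rewrite mulrDr. Qed.

Lemma binsumZ b c n (a : R) psi :
  binsum b c n (fun m => a * psi m) = a * binsum b c n psi.
Proof. by rewrite mulr_sumr; apply: eq_bigr => m _; rewrite mulrCA. Qed.

(** Size-biasing: [m C(n+1, m) = (n+1) C(n, m-1)] trades a factor m for one trial fewer and a shift
    of [psi]. *)
Lemma binsum_mul b c n psi :
  binsum b c n.+1 (fun m => m%:R * psi m) =
  n.+1%:R * b * binsum b c n (fun m => psi m.+1).
Proof.
rewrite /binsum big_ord_recl mul0r mulr0 add0r mulr_sumr.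
apply: eq_bigr => m _; rewrite /= /bump leq0n add1n subSS exprS.
have E : m.+1%:R * 'C(n.+1, m.+1)%:R = n.+1%:R * 'C(n, m)%:R :> R.
  by rewrite -!natrM -mul_bin_diag.
transitivity (m.+1%:R * 'C(n.+1, m.+1)%:R * (b * b ^+ m) * c ^+ (n - m) * psi m.+1).
  by ring.
by rewrite E; ring.
Qed.

Lemma binsum1 b c n : binsum b c n (fun=> 1) = (b + c) ^+ n.
Proof.
rewrite addrC exprDn; apply: eq_bigr => m _.
by rewrite mulr1 -[RHS]mulr_natl; ring.
Qed.

Lemma binsum_id b c n : binsum b c n.+1 (fun m => m%:R) = n.+1%:R * b * (b + c) ^+ n.
Proof.
rewrite -binsum1 -(binsum_mul b c n (fun=> 1)); apply: eq_binsum => m; by rewrite mulr1.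
Qed.

(** Squared bias plus variance; with [n.+2] trials the denominators [(b+c)^2] are absorbed in the
    power in front. *)
Lemma binsum_sqr_dist b c n (a : R) :
  binsum b c n.+2 (fun m => (a - m%:R) ^+ 2) =
  (b + c) ^+ n *
    ((a * (b + c) - n.+2%:R * b) ^+ 2 + n.+2%:R * b * c).
Proof.
rewrite (@eq_binsum _ _ _ _ (fun m => a ^+ 2 * 1 +
           (- (2 * a) * m%:R + m%:R * m%:R))); last by move=> m; ring.
rewrite !binsumD !binsumZ binsum1 binsum_id binsum_mul.
rewrite (@eq_binsum _ _ _ _ (fun m => m%:R + 1)); last by move=> m; rewrite natr1.
rewrite binsumD binsum1 binsum_id !exprS -!(natr1 n.+1).
by move: (_ ^+ n) => u; ring.
Qed.

(* Size-biasing three times turns the inverse third moment into a variance. *)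
Lemma binsum_inv_moment b c n : 0 < b -> 0 <= c -> (0 < n)%N ->
  binsum b c n
    (fun m => (0 < m)%:R * (b / (b + c) * n%:R - m%:R) ^+ 2 / m%:R ^+ 3) <=
  (b + c) ^+ n * (96 * (c / (b + c)) / ((b / (b + c)) ^+ 3 * n%:R ^+ 2)).
Proof.
(* Three size-biasing steps shift m by 3, so the center np moves along: [a - (m+3) = np - m]. *)
move=> b0 c0 n0; set s := b + c; set a := b / s * n%:R + 3.
have s0 : 0 < s by rewrite /s; lra.
have n1 : 1 <= n%:R :> R by rewrite ler1n.
pose phi m : R := (a - 3 - m%:R) ^+ 2 / (m.+1%:R * m.+2%:R * m.+3%:R).
(* For m >= 1, [(m+1)(m+2)(m+3) <= 24 m^3], with equality at m = 1; at m = 0 the left side is 0. *)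
have le1 : binsum b c n (fun m => (0 < m)%:R * (b / s * n%:R - m%:R) ^+ 2 / m%:R ^+ 3)
    <= 24 * binsum b c n phi.
  rewrite -binsumZ; apply: le_binsum => // [|m]; first exact: ltW.
  rewrite /phi /a addrK; set z := (_ - _) ^+ 2; have z0 : 0 <= z by exact: sqr_ge0.
  case: m @z z0 => [|m] z z0.
    rewrite mul0r mul0r; apply: mulr_ge0 => //; apply: divr_ge0 => //.
    by rewrite !mulr_ge0.
  rewrite mul1r [24 * _]mulrCA ler_wpM2l // -div1r ler_pdivrMr ?exprn_gt0 //.
  rewrite mulrAC ler_pdivlMr ?mulr_gt0 // mul1r.
  rewrite -(natr1 m.+3) -(natr1 m.+2) -(natr1 m.+1).
  have : 1 <= m.+1%:R :> R by rewrite ler1n.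
  move: (m.+1%:R : R) => x x1.
  have x2 : x <= x ^+ 2 by rewrite expr2 ler_peMr //; lra.
  have x3 : x ^+ 2 <= x ^+ 3 by rewrite [leRHS]exprS ler_peMl // sqr_ge0.
  have -> : (x + 1) * (x + 1 + 1) * (x + 1 + 1 + 1) = x ^+ 3 + 6 * x ^+ 2 + 11 * x + 6.
    by ring.
  lra.
(* Read backwards, size-biasing passes from n to n + 3 trials and cancels the denominator of [phi].
   The second moment about [a] remains, with bias [a s - (n+3) b = 3c]. *)
have le2 : n.+3%:R * b * (n.+2%:R * b * (n.+1%:R * b * binsum b c n phi)) <=
    s ^+ n.+1 * (9 * c ^+ 2 + n.+3%:R * b * c).
  pose psi m : R := (2 < m)%:R * (a - m%:R) ^+ 2 / (m%:R * (m%:R - 1) * (m%:R - 2)).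
  have -> : binsum b c n phi = binsum b c n (fun m => psi m.+3).
    apply: eq_binsum => m; rewrite /phi /psi mul1r -(natr1 m.+2) -(natr1 m.+1) -(natr1 m).
    by congr (_ / _); ring.
  have <- : binsum b c n.+3 (fun m => m%:R * ((m%:R - 1) * ((m%:R - 2) * psi m))) =
      n.+3%:R * b * (n.+2%:R * b * (n.+1%:R * b * binsum b c n (fun m => psi m.+3))).
    rewrite (binsum_mul b c _ (fun m => ((m%:R - 1) * ((m%:R - 2) * psi m)))).
    rewrite (@eq_binsum _ _ _ _ (fun m => m%:R * ((m%:R - 1) * psi m.+1))); last first.
      by move=> m; rewrite -natr1; ring.
    rewrite (binsum_mul b c _ (fun m => (m%:R - 1) * psi m.+1)).
    rewrite (@eq_binsum _ _ _ _ (fun m => m%:R * psi m.+2)); last first.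
      by move=> m; rewrite -natr1; ring.
    by rewrite (binsum_mul b c _ (fun m => psi m.+2)).
  have := @binsum_sqr_dist b c n.+1 a; rewrite -/s => V.
  have aE : a * s - n.+3%:R * b = 3 * c.
    rewrite /a -(natr1 n.+2) -(natr1 n.+1) -(natr1 n) /s; field.
    by rewrite gt_eqF.
  rewrite aE in V.
  have -> : 9 * c ^+ 2 = (3 * c) ^+ 2 by ring.
  rewrite -V; apply: le_binsum => // [|m]; first exact: ltW.
  rewrite /psi; case: (ltnP 2 m) => m2; last by rewrite !mul0r !mulr0 sqr_ge0.
  have : 3 <= m%:R :> R by rewrite ler_nat.
  move: (m%:R : R) => x x3; rewrite mul1r.
  have -> : x * ((x - 1) * ((x - 2) * ((a - x) ^+ 2 / (x * (x - 1) * (x - 2))))) =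
     (a - x) ^+ 2 by field; apply/and3P; split; apply/eqP; lra.
  by [].
apply: (le_trans le1).
have b3 : 0 < n.+3%:R * b * (n.+2%:R * b * (n.+1%:R * b)) by rewrite !mulr_gt0.
(* 96 = 24 * 4; the 4 comes from [n^2 (n+12) <= 4 (n+1)(n+2)(n+3)], the inequality left at the
   end. *)
have -> : s ^+ n * (96 * (c / s) / ((b / s) ^+ 3 * n%:R ^+ 2)) =
    24 * (s ^+ n * (4 * c * s ^+ 2 / (b ^+ 3 * n%:R ^+ 2))).
  move: (s ^+ n) => u; field; rewrite !gt_eqF //; lra.
rewrite ler_pM2l // -(ler_pM2l b3) -!mulrA.
move: le2; rewrite -!mulrA => le2; apply: le_trans le2 _.
rewrite exprS; have := exprn_gt0 n s0; move: (s ^+ n) => u u0.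
rewrite -(natr1 n.+2) -(natr1 n.+1) -(natr1 n).
move: (n%:R : R) n1 => x x1.
rewrite [leRHS](_ : _ =
    u * (s * (c * (s * (4 * ((x + 1 + 1 + 1) * (x + 1 + 1) * (x + 1) / x ^+ 2)))))); last first.
  by field; rewrite !gt_eqF //; lra.
rewrite [leLHS](_ : _ = u * (s * (c * (9 * c + (x + 3) * b)))); last by ring.
rewrite ler_pM2l // ler_pM2l // ler_wpM2l //.
have cs : 9 * c + (x + 3) * b <= s * (x + 12).
  by rewrite /s; nra.
apply: (le_trans cs); rewrite ler_pM2l //.
rewrite [leRHS]mulrA ler_pdivlMr ?exprn_gt0 //; last lra.
nra.
Qed.

(** The coordinates of a uniform [f] are independent, so the number landing in [B] is binomial:
    group the functions by the set [S] of such coordinates, then the sets by size. *)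
Lemma sum_ffun_card (J : finType) (B : {pred J}) n psi :
  \sum_(f : {ffun 'I_n -> J}) psi #|[set i | f i \in B]| =
  binsum #|B|%:R #|[predC B]|%:R n psi.
Proof.
rewrite (partition_big (fun f : {ffun 'I_n -> J} => [set i | f i \in B]) xpredT) //=.
transitivity (\sum_(S : {set 'I_n}) (#|B|%:R ^+ #|S| * #|[predC B]|%:R ^+ (n - #|S|)) *
    psi #|S|).
  apply: eq_bigr => S _.
  rewrite (eq_bigr (fun=> psi #|S|)); last by move=> f /eqP ->.
  rewrite sumr_const -[LHS]mulr_natl; congr (_ * _).
  pose F (i : 'I_n) : {pred J} := if i \in S then B else [predC B].
  have -> : #|[pred f : {ffun 'I_n -> J} | [set i | f i \in B] == S]| = #|family F|.
    apply: eq_card => f; rewrite !inE; apply/eqP/familyP => [ES i|H].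
      by rewrite /F -ES inE; case: ifP => // /negbT.
    apply/setP => i; rewrite inE; have := H i; rewrite /F.
    by case: ifP => // _; rewrite inE => /negbTE.
  rewrite card_family foldrE big_map big_enum natr_prod /=.
  rewrite (bigID (mem S)) /=; congr (_ * _).
    by rewrite -prodr_const; apply: eq_bigr => i iS; rewrite /F iS.
  rewrite (eq_bigr (fun=> #|[predC B]|%:R)); last by move=> i /negbTE iS; rewrite /F iS.
  have cardE : (#|S| + #|[predC S]| = n)%N by rewrite cardC card_ord.
  have -> : (n - #|S| = #|[predC S]|)%N by lia.
  by rewrite prodr_const.
have cS (S : {set 'I_n}) : (#|S| < n.+1)%N by rewrite ltnS -[X in (_ <= X)%N]card_ord max_card.
rewrite (partition_big (fun S : {set 'I_n} => Ordinal (cS S)) xpredT) //=.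
apply: eq_bigr => m _.
rewrite (eq_bigr (fun=> #|B|%:R ^+ m * #|[predC B]|%:R ^+ (n - m) * psi m)); last first.
  by move=> S /eqP <-.
rewrite sumr_const -[LHS]mulr_natl !mulrA; congr (_%:R * _ * _ * _).
have := card_draws 'I_n m; rewrite card_ord => <-; rewrite cardsE.
by apply: eq_card => S.
Qed.

End BinomialSums.

(** The shell with maximum t has at most [n * 2 * (2t+1)^(n-1)] points: a coordinate attaining t,
    two values for it, and a box for the others. As [2t+1 <= 3t], six box factors cancel [t^-6], and
    there are S shells. *)
Lemma sum_inv_max_pow6 (R : realType) (J : finType) (s : J -> nat) (n S : nat) :
  (forall t, #|[pred j | s j == t]| <= 2)%N ->
  (forall t, #|[pred j | s j <= t]| <= t.*2.+1)%N -> (7 <= n)%N ->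
  \sum_(f : {ffun 'I_n -> J} | (0 < \max_(i < n) s (f i) <= S)%N)
     ((\max_(i < n) s (f i))%N%:R ^+ 6)^-1
  <= (n * S)%:R * (2 * 3 ^+ 6 * S.*2.+1%:R ^+ (n - 7)) :> R.
Proof.
move=> s2 s21 n7.
(* [Q f i t] says that coordinate i attains the maximum t; several i may do so, hence a union
   bound. *)
pose Q (f : {ffun 'I_n -> J}) i t := (s (f i) == t) && [forall i', (s (f i') <= t)%N].
have le1 : \sum_(f : {ffun 'I_n -> J} | (0 < \max_(i < n) s (f i) <= S)%N)
     ((\max_(i < n) s (f i))%N%:R ^+ 6)^-1
  <= \sum_(f : {ffun 'I_n -> J}) \sum_(i < n) \sum_(t < S)
       (Q f i t.+1)%:R * (t.+1%:R ^+ 6)^-1 :> R.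
  rewrite big_mkcond; apply: ler_sum => f _.
  have pos i (t : nat) : 0 <= (Q f i t.+1)%:R * (t.+1%:R ^+ 6)^-1 :> R.
    by rewrite mulr_ge0 // invr_ge0 exprn_ge0.
  case: ifP => [/andP[m0 mS]|_]; last by do 2!(apply: sumr_ge0 => ? _).
  have n0 : (0 < #|'I_n|)%N by rewrite card_ord; lia.
  have [i iE] := bigop.eq_bigmax (fun i => s (f i)) n0.
  have maxP j : (s (f j) <= \max_(i < n) s (f i))%N := bigop.leq_bigmax j.
  move: (\max_(i < n) s (f i))%N m0 mS iE maxP => [//|t] _ tS iE maxP.
  rewrite (bigD1 i) //= [X in _ <= X + _](bigD1 (Ordinal tS)) //=.
  have -> : Q f i t.+1 by rewrite /Q iE eqxx -iE /=; apply/forallP.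
  rewrite mul1r -addrA lerDl addr_ge0 //; first exact: sumr_ge0.
  by apply: sumr_ge0 => ? _; apply: sumr_ge0.
apply: (le_trans le1); rewrite exchange_big /=.
have -> : (n * S)%:R * (2 * 3 ^+ 6 * S.*2.+1%:R ^+ (n - 7)) =
  \sum_(i < n) \sum_(t < S) 2 * 3 ^+ 6 * S.*2.+1%:R ^+ (n - 7) :> R.
  by rewrite !sumr_const !card_ord -mulrnA -[RHS]mulr_natl [(S * n)%N]mulnC.
apply: ler_sum => i _; rewrite exchange_big /=; apply: ler_sum => t _.
rewrite -mulr_suml -natr_sum.
have cQ : (\sum_f Q f i t.+1 <= 2 * t.+1.*2.+1 ^ n.-1)%N.
  pose F (i' : 'I_n) := if i' == i then [pred j | s j == t.+1] else [pred j | (s j <= t.+1)%N].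
  have -> : (\sum_f Q f i t.+1 = #|family F|)%N.
    rewrite -sum1_card [RHS]big_mkcond; apply: eq_bigr => f _.
    suff -> : (f \in family F) = Q f i t.+1 by case: (Q _ _ _).
    apply/familyP/andP => [H|[H1 /forallP H2] i'].
      have Hi : s (f i) == t.+1 by have := H i; rewrite /F eqxx inE.
      split=> //; apply/forallP => i'; have := H i'; rewrite /F.
      by case: eqP => [->|_]; rewrite inE // => /eqP ->.
    by rewrite /F; case: eqP => [->|_]; rewrite inE.
  rewrite card_family foldrE big_map big_enum /= (bigD1 i) //= {1}/F eqxx.
  apply: leq_mul; first exact: s2.
  have -> : (n.-1 = #|[pred i' : 'I_n | i' != i]|)%N.
    by have := cardC1 i; rewrite card_ord => <-; apply: eq_card => i'; rewrite !inE.
  rewrite -prod_nat_const; apply: leq_prod => i' /negbTE i'i.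
  by rewrite /F i'i; exact: s21.
have t0 : 0 < t.+1%:R ^+ 6 :> R by rewrite exprn_gt0.
rewrite ler_pdivrMr //.
have := cQ; rewrite -(ler_nat R) => /le_trans; apply.
rewrite -!natrX -!natrM ler_nat.
(* Six of the [n - 1] free coordinates pay for [t^-6]; the other [n - 7] are bounded by the largest
   shell. This is where n >= 7 enters. *)
have -> : (n.-1 = 6 + (n - 7))%N by lia.
have le6 : (t.+1.*2.+1 ^ 6 <= 3 ^ 6 * t.+1 ^ 6)%N by rewrite -expnMn leq_exp2r //; lia.
have leS : (t.+1.*2.+1 ^ (n - 7) <= S.*2.+1 ^ (n - 7))%N.
  by case: (n - 7)%N => // e; rewrite leq_exp2r //; have := ltn_ord t; lia.
rewrite expnD; move: (t.+1.*2.+1 ^ 6)%N (t.+1 ^ 6)%N (t.+1.*2.+1 ^ (n - 7))%N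
  (S.*2.+1 ^ (n - 7))%N (3 ^ 6)%N le6 leS => A C B D K le6 leS.
by rewrite -!mulnA leq_mul2l /= [(_ * C)%N]mulnC mulnA leq_mul.
Qed.

(** If [m >= pn/2], then [1 - H >= cp/2] and the first term suffices. Otherwise
    [(pn - m)^2 >= (pn/2)^2], and the second term dominates [(n/(cm))^3]. *)
Lemma inv_cube_split (R : realFieldType) (c p H n m : R) :
  0 < c -> 0 < p -> 0 < n -> 0 < m -> H ^+ 2 <= 1 -> c * m / n <= 1 - H ->
  H ^+ 2 / (1 - H) ^+ 3 <=
  (2 / (c * p)) ^+ 3 * H ^+ 2 + 4 * n / (c ^+ 3 * p ^+ 2) * ((p * n - m) ^+ 2 / m ^+ 3).
Proof.
move=> c0 p0 n0 m0 H1 HA.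
have w0 : 0 < c * m / n by rewrite divr_gt0 // mulr_gt0.
have A0 : 0 < 1 - H by exact: lt_le_trans HA.
have H0 := sqr_ge0 H.
have cube (x y : R) : 0 < x -> x <= y -> (y ^+ 3)^-1 <= (x^-1) ^+ 3.
  move=> x0 xy; rewrite exprVn lef_pV2 ?posrE ?exprn_gt0 ?(lt_le_trans x0) //.
  by rewrite lerXn2r ?nnegrE ?(ltW x0) ?(le_trans (ltW x0)).
have T0 : 0 <= 4 * n / (c ^+ 3 * p ^+ 2) * ((p * n - m) ^+ 2 / m ^+ 3).
  rewrite mulr_ge0 // divr_ge0 ?sqr_ge0 ?mulr_ge0 ?exprn_ge0 //; exact: ltW.
case: (lerP (p * n / 2) m) => pm.
  apply: (@le_trans _ _ ((2 / (c * p)) ^+ 3 * H ^+ 2)); last first.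
    by rewrite lerDl.
  rewrite [leLHS]mulrC; apply: ler_wpM2r => //.
  have -> : 2 / (c * p) = (c * p / 2)^-1 by field; rewrite !gt_eqF.
  apply: cube; first by rewrite divr_gt0 ?mulr_gt0.
  apply: le_trans HA; rewrite -!mulrA ler_pM2l // ler_pdivlMr //; lra.
apply: (@le_trans _ _ (4 * n / (c ^+ 3 * p ^+ 2) * ((p * n - m) ^+ 2 / m ^+ 3))); last first.
  by rewrite lerDr mulr_ge0 // exprn_ge0 // divr_ge0 // mulr_ge0 // ltW.
apply: (@le_trans _ _ (((c * m / n)^-1) ^+ 3)).
  apply: le_trans (cube _ _ w0 HA).
  by rewrite ler_piMl // invr_ge0 exprn_ge0 // ltW.
have -> : ((c * m / n)^-1) ^+ 3 = 4 * n / (c ^+ 3 * p ^+ 2) * ((p * n / 2) ^+ 2 / m ^+ 3).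
  by field; rewrite !gt_eqF.
rewrite ler_pM2l ?divr_gt0 ?mulr_gt0 ?exprn_gt0 //.
rewrite ler_pM2r ?invr_gt0 ?exprn_gt0 //.
have pn : 0 < p * n by rewrite mulr_gt0.
by rewrite lerXn2r ?nnegrE; lra.
Qed.

(** * Summation over the dual torus *)

Section ModeCounts.
Variable r' : nat.
Local Notation r := r'.+2.
Local Notation mode := (@mode r').

Lemma card_ord_le_size (A : {pred 'I_r}) (s : seq nat) :
  (forall j, j \in A -> val j \in s) -> (#|A| <= size s)%N.
Proof.
move=> As; rewrite cardE -(size_map val); apply: uniq_leq_size.
  by rewrite map_inj_uniq ?enum_uniq //; exact: val_inj.
by move=> _ /mapP[j jA ->]; apply: As; rewrite mem_enum in jA.
Qed.

Lemma card_mode_eq t : (#|[pred j | mode j == t]| <= 2)%N.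
Proof.
apply: (@card_ord_le_size _ [:: (r.-1./2 + t)%N; (r.-1./2 - t)%N]) => j.
by rewrite !inE /mode /= => /eqP H; apply/orP; lia.
Qed.

Lemma card_mode_le t : (#|[pred j | (mode j <= t)%N]| <= t.*2.+1)%N.
Proof.
rewrite -[leqRHS](size_iota (r.-1./2 - t)); apply: card_ord_le_size => j.
by rewrite !inE /mode /= mem_iota; lia.
Qed.

Lemma card_predCE (B : {pred 'I_r}) : (#|B| + #|[predC B]| = r)%N.
Proof. by rewrite cardC card_ord. Qed.

End ModeCounts.

(** * Sum over the dual points with at least one large coordinate *)

Section Estimates.
Variables (R : realType) (r' n : nat) (e : rel (torus r'.+2 n)).
Local Notation r := r'.+2.
Hypothesis (inv_e : translation_invariant e) (sym_e : symmetric e).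
Hypothesis (Om_gt0 : (0 < Omega e)%N).
Implicit Types (f : {ffun 'I_n -> 'I_r}) (B : {pred 'I_r}).
Local Notation hat := (@hat R r' n e).
Local Notation vol := ((r ^ n)%:R : R).
Local Notation Om := ((Omega e)%:R : R).

Lemma edge_oppr x : e 0 (- x) = e 0 x.
Proof. by rewrite -(inv_e _ _ x) add0r addNr sym_e. Qed.

(** Every term [1 - cos] is nonnegative, so keeping only a family of distinct neighbors gives a
    lower bound. *)
Lemma edge_sum_ge (I : finType) (P : pred I) (g : I -> torus r n) f :
  {in P &, injective g} -> (forall i, P i -> e 0 (g i)) ->
  \sum_(i | P i) (1 - cos (kdot (dual_point R f) (g i))) <=
  \sum_(x | e 0 x) (1 - cos (kdot (dual_point R f) x)).
Proof.
move=> g_inj Pe.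
rewrite -(big_imset (fun x => 1 - cos (kdot (dual_point R f) x)) g_inj).
rewrite big_mkcond [leRHS]big_mkcond; apply: ler_sum => x _.
case: ifP => [/imsetP[i iP ->]|_]; first by rewrite Pe.
by case: ifP => // _; rewrite subr_ge0 cos_le1.
Qed.

(** The binomial variable M; [B] will be the set of indices whose mode exceeds a threshold. *)
Definition large B f : nat := #|[set i | f i \in B]|.

(** The pointwise split is summed: Parseval handles the first term, the binomial inverse moment the
    second, and 384 = 4 * 96. *)
Lemma sum_large B (c : R) : 0 < c -> (0 < #|B|)%N -> (0 < n)%N ->
  (forall f, (0 < large B f)%N -> c * (large B f)%:R / n%:R <= 1 - hat f) ->
  \sum_(f | (0 < large B f)%N) hat f ^+ 2 / (1 - hat f) ^+ 3 <=
  vol * ((2 / (c * (#|B|%:R / r%:R))) ^+ 3 / Om +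
    384 * (#|[predC B]|%:R / r%:R) / (c ^+ 3 * (#|B|%:R / r%:R) ^+ 5 * n%:R)).
Proof.
move=> c0 B0 n0 Hc; set p := #|B|%:R / r%:R; set q := #|[predC B]|%:R / r%:R.
have p0 : 0 < p by rewrite divr_gt0 ?ltr0n.
have nR0 : 0 < n%:R :> R by rewrite ltr0n.
pose psi m : R := (0 < m)%:R * (p * n%:R - m%:R) ^+ 2 / m%:R ^+ 3.
have le1 : \sum_(f | (0 < large B f)%N) hat f ^+ 2 / (1 - hat f) ^+ 3 <=
    \sum_f ((2 / (c * p)) ^+ 3 * hat f ^+ 2 +
            4 * n%:R / (c ^+ 3 * p ^+ 2) * psi (large B f)).
  rewrite big_mkcond; apply: ler_sum => f _.
  case: ifP => [M0|/negbT]; last first.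
    rewrite -eqn0Ngt => /eqP M0; rewrite /psi M0 !mul0r mulr0 addr0.
    by rewrite mulr_ge0 ?sqr_ge0 // exprn_ge0 // divr_ge0 // mulr_ge0 // ltW.
  rewrite /psi M0 mul1r.
  by apply: inv_cube_split => //; rewrite ?ltr0n ?hat_sqr_le1 ?Hc.
apply: (le_trans le1); rewrite big_split /= -!mulr_sumr parseval; last exact: edge_oppr.
rewrite mulrDr; apply: lerD; first by rewrite mulrCA.
rewrite (sum_ffun_card B n psi).
have := @binsum_inv_moment R #|B|%:R #|[predC B]|%:R n.
have -> : #|B|%:R + #|[predC B]|%:R = r%:R :> R by rewrite -natrD card_predCE.
rewrite ltr0n -/p -/q => /(_ B0 (ler0n _ _) n0) le2.
have K0 : 0 <= 4 * n%:R / (c ^+ 3 * p ^+ 2).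
  by rewrite ltW // divr_gt0 // mulr_gt0 // exprn_gt0.
apply: (le_trans (ler_wpM2l K0 le2)); rewrite natrX.
move: (r%:R ^+ n) => V; rewrite le_eqVlt; apply/orP; left; apply/eqP.
by field; rewrite !gt_eqF.
Qed.

End Estimates.

(** * Lower bounds for nearest-neighbor and Hamming tori *)

Section UnitVectors.
Variables (R : realType) (r' n : nat).
Local Notation r := r'.+2.
Implicit Types (f : {ffun 'I_n -> 'I_r}).

(** The sup norm of r k / (2 pi) at the dual point k of [f]. *)
Definition max_mode f : nat := \max_(i < n) mode (f i).

Lemma mode_le_max f i : (mode (f i) <= max_mode f)%N.
Proof. exact: (bigop.leq_bigmax i). Qed.

Lemma max_mode_gt0 f : (0 < max_mode f)%N = ~~ [forall i, mode (f i) == 0%N].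
Proof.
rewrite negb_forall; apply/idP/existsP => [m0|[j mj]]; last first.
  by rewrite (leq_trans _ (mode_le_max _ j)) // lt0n.
apply/existsP; rewrite -negb_forall; apply: contraL m0 => /forallP all0.
by rewrite -eqn0Ngt -leqn0; apply/bigmax_leqP => i _; rewrite leqn0.
Qed.

Lemma max_modeP f : (0 < n)%N -> exists i, max_mode f = mode (f i).
Proof.
move=> n0; have c0 : (0 < #|'I_n|)%N by rewrite card_ord.
by have [i iE] := bigop.eq_bigmax (fun i => mode (f i)) c0; exists i.
Qed.

Definition unit_vec (i : 'I_n) (a : 'Z_r) : torus r n :=
  \row_j (if j == i then a else 0).

Lemma unit_vecE i a : unit_vec i a 0 i = a.
Proof. by rewrite mxE eqxx. Qed.

Lemma unit_vec_inj i j a b : a != 0 -> unit_vec i a = unit_vec j b -> i = j /\ a = b.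
Proof.
move=> a0 E; have := congr1 (fun x : torus r n => x 0 i) E.
rewrite unit_vecE mxE; case: eqP => [-> //|_ /eqP]; by rewrite (negbTE a0).
Qed.

Lemma kdot_unit_vec f i (a : 'Z_r) :
  kdot (dual_point R f) (unit_vec i a) = freq R (f i) * (a : nat)%:R.
Proof.
rewrite /kdot (bigD1 i) //= big1 => [|j /negbTE ji]; first by rewrite !mxE eqxx addr0.
by rewrite !mxE ji mulr0.
Qed.

Lemma one_sub_cos_freq_ge (j : 'I_r) :
  8 * ((mode j)%:R / r%:R) ^+ 2 <= 1 - cos (freq R j * 1%:R).
Proof. by rewrite cos_freqM muln1; apply: one_sub_cos_ge => //; exact: mode_le. Qed.

(** For a nonzero mode the cosines over a full period sum to 0, being the real part of a geometric
    sum of roots of unity. *)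
Lemma sum_one_sub_cos_freq (j : 'I_r) : (0 < mode j)%N ->
  \sum_(a : 'I_r) (1 - cos (freq R j * (a : nat)%:R)) = r%:R.
Proof.
move=> j0; set w := expi (freq R j).
have w1 : w != 1.
  apply/negP => /eqP /(congr1 (@complex.Re R)) /= cos1.
  have := one_sub_cos_freq_ge j; rewrite mulr1 cos1 subrr leNgt.
  by rewrite mulr_gt0 // exprn_gt0 // divr_gt0 ?ltr0n.
have : \sum_(a < r) w ^+ a = 0.
  apply/eqP; rewrite -(inj_eq (mulfI (_ : w - 1 != 0))) ?subr_eq0 //.
  by rewrite -subrX1 -expiMn expi_freq_r subrr mulr0.
under eq_bigr do rewrite -expiMn.
move=> /(congr1 (@complex.Re R)).
rewrite (big_morph (@complex.Re R) (id1 := 0) (op1 := +%R)) //=; last by case=> ? ? [].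
by rewrite sumrB => ->; rewrite subr0 sumr_const card_ord.
Qed.

End UnitVectors.

(** * Degree and Fourier gap of the nearest-neighbor torus *)

Section NearestNeighbor.
Variables (R : realType) (r' n : nat).
Local Notation r := r'.+2.
Local Notation e := (@nn_edge r n).
Implicit Types (f : {ffun 'I_n -> 'I_r}).

Lemma nn_edge_sym : symmetric e.
Proof.
move=> x y; apply: eq_existsb => i; rewrite orbC; congr (_ && _).
by apply: eq_forallb => j; rewrite [x 0 j == _]eq_sym.
Qed.

Lemma nn_edge_unit i : e 0 (unit_vec i 1).
Proof.
apply/existsP; exists i; rewrite !mxE eqxx subr0 eqxx orbT /=.
by apply/forallP => j; apply/implyP => /negbTE ji; rewrite !mxE ji.
Qed.

Lemma nn_Omega_gt0 : (0 < n)%N -> (0 < Omega e)%N.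
Proof.
move=> n0; rewrite /Omega /degree card_gt0; apply/set0Pn.
by exists (unit_vec (Ordinal n0) 1); rewrite inE nn_edge_unit.
Qed.

(** The neighbors of 0 are the signed unit vectors; the two signs coincide when r = 2, hence an
    inequality. *)
Lemma nn_Omega_le : (Omega e <= 2 * n)%N.
Proof.
pose g (p : 'I_n * bool) : torus r n := unit_vec p.1 (if p.2 then 1 else - 1).
apply: (@leq_trans #|g @: [set: 'I_n * bool]|); last first.
  apply: leq_trans (leq_imset_card _ _) _.
  by rewrite cardsT card_prod card_ord card_bool mulnC.
apply: subset_leq_card; apply/subsetP => x; rewrite inE => /existsP[i /andP[xi /forallP xj]].
apply/imsetP; exists (i, x 0 i == 1) => //; apply/rowP => j; rewrite !mxE /=.
case: eqP => [->|/eqP ji]; last by have := xj j; rewrite ji mxE => /eqP <-.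
move: xi; rewrite mxE sub0r subr0; case: (x 0 i =P 1) => [//|_].
by rewrite orbF => /eqP <-; rewrite opprK.
Qed.

(** Only the n neighbors with entry 1 are kept, each giving [8 (mode/r)^2]; [Omega <= 2n] turns 8
    into 4/n. *)
Lemma nn_hat_lower f : (0 < n)%N ->
  4 / n%:R * \sum_(i < n) ((mode (f i))%:R / r%:R) ^+ 2 <= 1 - hat R e f.
Proof.
move=> n0; rewrite one_sub_hat ?nn_Omega_gt0 //.
have O0 := nn_Omega_gt0 n0.
have g_inj : {in xpredT &, injective (fun i : 'I_n => @unit_vec r' n i 1)}.
  by move=> i j _ _ /unit_vec_inj[].
have le1 := edge_sum_ge R f g_inj (fun i _ => nn_edge_unit i).
apply: (@le_trans _ _ ((Omega e)%:R^-1 * \sum_(i < n) 8 * ((mode (f i))%:R / r%:R) ^+ 2)).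
  rewrite -mulr_sumr mulrA ler_wpM2r //.
    by apply: sumr_ge0 => i _; exact: sqr_ge0.
  rewrite [leRHS]mulrC ler_pdivrMr ?ltr0n // mulrAC ler_pdivlMr ?ltr0n //.
  have := nn_Omega_le; rewrite -(ler_nat R) natrM; lra.
rewrite ler_wpM2l ?invr_ge0 //; apply: le_trans le1; apply: ler_sum => i _.
by rewrite kdot_unit_vec; exact: one_sub_cos_freq_ge.
Qed.

End NearestNeighbor.

(** * Degree and Fourier gap of the Hamming torus *)

Section Hamming.
Variables (R : realType) (r' n : nat).
Local Notation r := r'.+2.
Local Notation e := (@hamming_edge r n).
Implicit Types (f : {ffun 'I_n -> 'I_r}).

Lemma hamming_edge_sym : symmetric e.
Proof.
move=> x y; congr (_ == _); apply: eq_card => i.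
by rewrite !inE eq_sym.
Qed.

Lemma hamming_edge_unit i a : a != 0 -> e 0 (unit_vec i a).
Proof.
move=> a0; apply/cards1P; exists i; apply/setP => j; rewrite !inE !mxE eq_sym.
by case: (j =P i) => // _; rewrite eqxx.
Qed.

Lemma hamming_Omega_gt0 : (0 < n)%N -> (0 < Omega e)%N.
Proof.
move=> n0; rewrite /Omega /degree card_gt0; apply/set0Pn.
by exists (unit_vec (Ordinal n0) 1); rewrite inE hamming_edge_unit.
Qed.

Lemma hamming_Omega_le : (Omega e <= n * r)%N.
Proof.
pose g (p : 'I_n * 'I_r) : torus r n := unit_vec p.1 p.2.
apply: (@leq_trans #|g @: [set: 'I_n * 'I_r]|); last first.
  by apply: leq_trans (leq_imset_card _ _) _; rewrite cardsT card_prod !card_ord.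
apply: subset_leq_card; apply/subsetP => x; rewrite inE => /cards1P[i iE].
apply/imsetP; exists (i, x 0 i) => //; apply/rowP => j; rewrite !mxE /=.
case: eqP => [->//|/eqP ji]; have : j \notin [set i] by rewrite inE.
by rewrite -iE inE negbK mxE => /eqP.
Qed.

(** Along each coordinate with nonzero mode the terms [1 - cos] add up to r, and [Omega <= nr]. The
    factor 1 is the constant [c] of [sum_large]. *)
Lemma hamming_hat_lower f : (0 < n)%N ->
  1 * (large [pred j | mode j != 0%N] f)%:R / n%:R <= 1 - hat R e f.
Proof.
move=> n0; have O0 := hamming_Omega_gt0 n0; rewrite one_sub_hat //.
pose g (p : 'I_n * 'I_r) : torus r n := unit_vec p.1 p.2.
pose P (p : 'I_n * 'I_r) := p.2 != 0 :> 'Z_r.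
have g_inj : {in P &, injective g}.
  by move=> [i a] [j b] a0 _ /unit_vec_inj[] // /= -> ->.
have le1 := edge_sum_ge R f g_inj (fun p => hamming_edge_unit p.1 (a := p.2)).
apply: (@le_trans _ _ ((Omega e)%:R^-1 * (r%:R * (large [pred j | mode j != 0%N] f)%:R))).
  rewrite mul1r mulrC mulrA ler_wpM2r // ler_pdivlMl ?ltr0n //.
  rewrite ler_pdivrMr ?ltr0n // mulrC -natrM ler_nat; exact: hamming_Omega_le.
rewrite ler_wpM2l ?invr_ge0 //; apply: le_trans le1.
rewrite (eq_bigr (fun p : 'I_n * 'I_r => 1 - cos (freq R (f p.1) * (p.2 : nat)%:R))); last first.
  by move=> p _; rewrite kdot_unit_vec.
(* The excluded entries [a = 0] contribute [1 - cos 0 = 0], so full periods can be summed. *)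
have -> : \sum_(p | P p) (1 - cos (freq R (f p.1) * (p.2 : nat)%:R)) =
  \sum_(i < n) \sum_(a < r) (1 - cos (freq R (f i) * (a : nat)%:R)).
  rewrite pair_big /= big_mkcond; apply: eq_bigr => [[i a] _] /=.
  by rewrite /P /=; case: eqP => // ->; rewrite mulr0 cos0 subrr.
rewrite mulr_natr /large -sumr_const big_mkcond /=; apply: ler_sum => i _.
rewrite !inE; case: eqP => /= [_|/eqP]; last by rewrite -lt0n => /(sum_one_sub_cos_freq R) ->.
by apply: sumr_ge0 => a _; rewrite subr_ge0 cos_le1.
Qed.

End Hamming.

(** * The first two tori *)

Section TwoTori.
Variable R : realType.

(** Monotonicity in the densities p and q replaces them by bounds, so that constants can be chosen
    independently of r. *)
Lemma sum_large_le (r' n : nat) (e : rel (torus r'.+2 n)) (B : {pred 'I_r'.+2})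
    (c p0 q0 : R) :
  translation_invariant e -> symmetric e ->
  0 < c -> 0 < p0 -> (0 < n)%N ->
  p0 <= #|B|%:R / r'.+2%:R -> #|[predC B]|%:R / r'.+2%:R <= q0 ->
  (forall f, (0 < large B f)%N -> c * (large B f)%:R / n%:R <= 1 - hat R e f) ->
  \sum_(f : {ffun 'I_n -> 'I_r'.+2} | (0 < large B f)%N) hat R e f ^+ 2 / (1 - hat R e f) ^+ 3 <=
  (r'.+2 ^ n)%:R * ((2 / (c * p0)) ^+ 3 / (Omega e)%:R + 384 / (c ^+ 3 * p0 ^+ 5) * (q0 / n%:R)).
Proof.
move=> inv_e sym_e c0 p00 n0 pB qB H.
have B0 : (0 < #|B|)%N.
  rewrite lt0n; apply/eqP => B0; move: pB; rewrite B0 mul0r; lra.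
apply: le_trans (sum_large inv_e sym_e c0 B0 n0 H) _.
move: pB qB; set p := _ / _; set q := _ / _ => pB qB.
have p_gt0 : 0 < p by exact: lt_le_trans pB.
have q_ge0 : 0 <= q by rewrite divr_ge0.
clearbody p q.
have nR0 : 0 < n%:R :> R by rewrite ltr0n.
have V0 : 0 <= (r'.+2 ^ n)%:R :> R by [].
rewrite ler_wpM2l //; apply: lerD.
  have le_cp : 2 / (c * p) <= 2 / (c * p0).
    rewrite ler_pM2l // lef_pV2 ?posrE ?mulr_gt0 //.
    by apply: ler_wpM2l => //; exact: ltW.
  have cp0 : 0 <= 2 / (c * p) by rewrite ltW // divr_gt0 // mulr_gt0.
  rewrite ler_wpM2r ?invr_ge0 // lerXn2r ?nnegrE //; exact: le_trans le_cp.
have -> : 384 * q / (c ^+ 3 * p ^+ 5 * n%:R) = 384 / c ^+ 3 / n%:R * (q * (p ^+ 5)^-1).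
  by field; rewrite !gt_eqF.
have -> : 384 / (c ^+ 3 * p0 ^+ 5) * (q0 / n%:R) = 384 / c ^+ 3 / n%:R * (q0 * (p0 ^+ 5)^-1).
  by field; rewrite !gt_eqF.
apply: ler_wpM2l.
  by apply: divr_ge0 => //; apply: divr_ge0 => //; rewrite exprn_ge0 // ltW.
apply: ler_pM => //; first by rewrite invr_ge0 exprn_ge0 // ltW.
by rewrite lef_pV2 ?posrE ?exprn_gt0 // lerXn2r ?nnegrE // ltW.
Qed.

(** With [B] the nonzero modes, M = 0 only at k = 0, so every term is covered; here p >= 1/2 and q
    <= 1/r. *)
Lemma hamming_A_cond (r' n : nat) : (0 < n)%N ->
  A_cond (@hamming_edge r'.+2 n)
    ((1 + (2 / (1 * 2^-1)) ^+ 3 + 384 / (1 ^+ 3 * 2^-1 ^+ 5)) *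
       (Omega (@hamming_edge r'.+2 n))%:R^-1 : R).
Proof.
move=> n0; set K1 := (2 / _) ^+ 3; set K2 := 384 / _.
have inv_e := @hamming_edge_invariant r'.+2 n.
have sym_e := @hamming_edge_sym r' n.
have K10 : 0 <= K1 by rewrite /K1 !(exprn_ge0, divr_ge0, mulr_ge0, invr_ge0).
have K20 : 0 <= K2 by rewrite /K2 !(exprn_ge0, divr_ge0, mulr_ge0, invr_ge0).
have Om0 : 0 < (Omega (@hamming_edge r'.+2 n))%:R :> R.
  by rewrite ltr0n hamming_Omega_gt0.
have rR0 : 0 < r'.+2%:R :> R by [].
have nR0 : 0 < n%:R :> R by rewrite ltr0n.
apply: A_cond_real => [x||]; [exact: edge_oppr | lra |].
pose B := [pred j : 'I_r'.+2 | mode j != 0%N].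
have cBC : (#|[predC B]| <= 1)%N.
  apply: leq_trans (card_mode_le r' 0); apply: subset_leq_card; apply/subsetP => j.
  by rewrite !inE leqn0 negbK.
rewrite (eq_bigl (fun f => (0 < large B f)%N)); last first.
  move=> f; rewrite negb_forall card_gt0; apply/existsP/set0Pn.
    by case=> i mi; exists i; rewrite !inE.
  by case=> i; rewrite !inE => mi; exists i.
have hc (f : {ffun 'I_n -> 'I_r'.+2}) : (0 < large B f)%N ->
    1 * (large B f)%:R / n%:R <= 1 - hat R (@hamming_edge r'.+2 n) f.
  by move=> _; exact: hamming_hat_lower.
have pB : 2^-1 <= #|B|%:R / r'.+2%:R :> R.
  rewrite ler_pdivlMr // mulrC ler_pdivrMr // -natrM ler_nat.
  have : (r'.+2 <= #|B| + 1)%N by rewrite -[leqLHS](card_predCE B) leq_add2l.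
  by lia.
have qB : #|[predC B]|%:R / r'.+2%:R <= r'.+2%:R^-1 :> R.
  by rewrite ler_pdivrMr // mulVf ?gt_eqF // lern1.
apply: le_trans (sum_large_le inv_e sym_e _ _ n0 pB qB hc) _; rewrite ?invr_gt0 //.
rewrite -/K1 -/K2 ler_wpM2l //.
(* The factor 1/r from q is what brings 1/n down to order 1/Omega, through [Omega <= nr]. *)
suff : K2 * (r'.+2%:R^-1 / n%:R) <= K2 / (Omega (@hamming_edge r'.+2 n))%:R.
  have : 0 <= (Omega (@hamming_edge r'.+2 n))%:R^-1 :> R by rewrite invr_ge0.
  move: (K2 * (_ / _)) (_^-1) => t y y0 ty.
  by rewrite !mulrDl mul1r; apply: lerD => //; rewrite lerDr.
rewrite ler_wpM2l // -invfM lef_pV2 ?posrE ?mulr_gt0 //.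
by rewrite -natrM ler_nat mulnC hamming_Omega_le.
Qed.

(** For [S = r %/ 4]: at least a quarter of the indices have mode above S. *)
Lemma quarter_complement (r S b : nat) :
  (2 <= r)%N -> (S * 4 <= r)%N -> (r <= b + S.*2.+1)%N -> (r <= b * 4)%N.
Proof. by lia. Qed.

Lemma quarter_double (r S : nat) :
  (2 <= r)%N -> (S * 4 <= r)%N -> (S.*2.+1 * 4 <= 3 * r)%N.
Proof. by lia. Qed.

(** The left side is nonincreasing in k: from 20 on, one step multiplies the fifth power by at most
    [(21/20)^5 <= 4/3]. *)
Lemma pow5_geometric (k : nat) : (k + 20)%:R ^+ 5 * (3 / 4) ^+ k <= 20 ^+ 5 :> R.
Proof.
elim: k => [|k IH]; first by rewrite mulr1.
apply: le_trans IH; rewrite [_ ^+ k.+1]exprS mulrA ler_wpM2r ?exprn_ge0 ?divr_ge0 //.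
have : 20 <= (k + 20)%:R :> R by rewrite ler_nat leq_addl.
rewrite addSn -(natr1 (k + 20)); move: ((k + 20)%:R : R) => x x20.
have le1 : (x + 1) ^+ 5 <= (21 / 20 * x) ^+ 5 by rewrite lerXn2r ?nnegrE; lra.
have x5 : 0 <= x ^+ 5 by rewrite exprn_ge0 //; lra.
rewrite exprMn in le1.
have le2 : (21 / 20) ^+ 5 <= 4 / 3 :> R by rewrite !exprS expr0; lra.
have := le_trans le1 (ler_wpM2r x5 le2).
move: ((x + 1) ^+ 5) (x ^+ 5) => a b; lra.
Qed.

(** Cut at [S = r %/ 4]. If some mode exceeds S, [sum_large_le] applies with [c = p0 = 1/4];
    otherwise the point lies in a box, where shells are summed and the box ratio 3/4 to the power
    [n - 7] beats the powers of n. *)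
Lemma nn_A_cond (r' n : nat) : (7 <= n)%N ->
  A_cond (@nn_edge r'.+2 n)
    ((1 + (2 / (4^-1 * 4^-1)) ^+ 3 + 2 * (384 / (4^-1 ^+ 3 * 4^-1 ^+ 5))
        + 2 * (2 * 3 ^+ 6 * 20 ^+ 5)) *
       (Omega (@nn_edge r'.+2 n))%:R^-1 : R).
Proof.
move=> n7; have n0 : (0 < n)%N by lia.
set r := r'.+2; set K1 := (2 / _) ^+ 3; set K2 := 384 / _; set K3 := 2 * _ * _.
set e := @nn_edge r n.
have inv_e : translation_invariant e by exact: nn_edge_invariant.
have sym_e : symmetric e by exact: nn_edge_sym.
have K10 : 0 <= K1 by rewrite /K1 !(exprn_ge0, divr_ge0, mulr_ge0, invr_ge0).
have K20 : 0 <= K2 by rewrite /K2 !(exprn_ge0, divr_ge0, mulr_ge0, invr_ge0).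
have K30 : 0 <= K3 by rewrite /K3 !(exprn_ge0, mulr_ge0).
have Om0 : 0 < (Omega e)%:R :> R by rewrite ltr0n nn_Omega_gt0.
have rR0 : 0 < r%:R :> R by [].
have nR0 : 0 < n%:R :> R by rewrite ltr0n.
have Omn : n%:R^-1 <= 2 / (Omega e)%:R :> R.
  rewrite ler_pdivlMr // mulrC ler_pdivrMr // -natrM ler_nat; exact: nn_Omega_le.
apply: A_cond_real => [x||]; [exact: edge_oppr | lra |].
pose S := (r %/ 4)%N; have S4 : (S * 4 <= r)%N := leq_trunc_div r 4.
pose B := [pred j : 'I_r | (S < mode j)%N].
rewrite (bigID (fun f => 0 < large B f)%N) /=.
have le1 : \sum_(f : {ffun 'I_n -> 'I_r} | ~~ [forall i, mode (f i) == 0%N] && (0 < large B f)%N)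
      hat R e f ^+ 2 / (1 - hat R e f) ^+ 3 <= (r ^ n)%:R * (K1 / (Omega e)%:R + K2 * (1 / n%:R)).
  rewrite (eq_bigl (fun f => (0 < large B f)%N)); last first.
    move=> f; rewrite andb_idl // card_gt0 negb_forall => /set0Pn [j].
    by rewrite !inE => mi; apply/existsP; exists j; rewrite -lt0n (leq_trans _ mi).
  apply: sum_large_le => //; rewrite ?invr_gt0 //.
  - rewrite ler_pdivlMr // mulrC ler_pdivrMr // -natrM ler_nat.
    have : (#|[predC B]| <= S.*2.+1)%N.
      apply: leq_trans (card_mode_le r' S); apply: subset_leq_card; apply/subsetP => j.
      by rewrite !inE -leqNgt.
    move=> cBC; apply: (quarter_complement _ S4) => //.
    by rewrite -[leqLHS](card_predCE B) leq_add2l.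
  - by rewrite ler_pdivrMr // mul1r ler_nat -[leqRHS](card_predCE B) leq_addl.
  move=> f M0; apply: le_trans (nn_hat_lower R f n0).
  rewrite [leLHS](_ : _ = n%:R^-1 * (4^-1 * (large B f)%:R)); last by ring.
  rewrite -[leRHS]mulrA [leRHS]mulrCA ler_wpM2l ?invr_ge0 //.
  rewrite /large -sum1_card natr_sum !mulr_sumr big_mkcond /=.
  apply: ler_sum => i _; rewrite !inE; case: ifP => Si; last by rewrite mulr_ge0 ?sqr_ge0.
  (* A mode above S exceeds r/4, so [4 (mode/r)^2 >= 1/4], which is the constant [c]. *)
  rewrite mulr1; have : 1 <= 4 * ((mode (f i))%:R / r%:R) :> R.
    by rewrite mulrA ler_pdivlMr // mul1r -natrM ler_nat; move: Si;
      rewrite /S ltn_divLR // mulnC => /ltnW.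
  by move: (_ / _) => y y1; nra.
have le2 : \sum_(f : {ffun 'I_n -> 'I_r} | ~~ [forall i, mode (f i) == 0%N] && ~~ (0 < large B f)%N)
      hat R e f ^+ 2 / (1 - hat R e f) ^+ 3 <= (r ^ n)%:R * (K3 / n%:R).
  apply: (@le_trans _ _ (\sum_(f : {ffun 'I_n -> 'I_r} | (0 < \max_(i < n) mode (f i) <= S)%N)
      n%:R ^+ 3 * r%:R ^+ 6 * ((\max_(i < n) mode (f i))%N%:R ^+ 6)^-1)).
    rewrite (eq_bigl (fun f : {ffun 'I_n -> 'I_r} =>
      (0 < \max_(i < n) mode (f i) <= S)%N)); last first.
      move=> f; rewrite -max_mode_gt0; congr (_ && _); rewrite -eqn0Ngt cards_eq0.
      apply/eqP/bigmax_leqP => [E i _|E].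
        by have /setP/(_ i) := E; rewrite !inE => /negbT; rewrite -leqNgt.
      by apply/setP => i; rewrite !inE ltnNge E.
    apply: ler_sum => f /andP[m0 _].
    have [i iE] := max_modeP f n0; rewrite -/(max_mode f) in m0 *.
    move: m0; rewrite iE -(ltr0n R) => m0.
    (* One coordinate attaining the maximum x is enough; without the factor 4, the inverse cube of
       the bound is [n^3 r^6 / x^6]. *)
    have lowA : 4 / n%:R * ((mode (f i))%:R / r%:R) ^+ 2 <= 1 - hat R e f.
      apply: le_trans (nn_hat_lower R f n0); rewrite ler_wpM2l ?divr_ge0 //.
      by rewrite (bigD1 i) //= lerDl sumr_ge0 // => j _; exact: sqr_ge0.
    set x := (mode (f i))%:R : R; rewrite -/x in m0 lowA.
    have w0 : 0 < (x / r%:R) ^+ 2 / n%:R by rewrite divr_gt0 // exprn_gt0 // divr_gt0.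
    have lowA' : (x / r%:R) ^+ 2 / n%:R <= 1 - hat R e f.
      by apply: le_trans lowA; rewrite mulrAC; move: w0; rewrite mulrC; lra.
    have A0 : 0 < 1 - hat R e f by exact: lt_le_trans lowA'.
    apply: (@le_trans _ _ ((1 - hat R e f) ^+ 3)^-1).
      by rewrite ler_piMl ?hat_sqr_le1 // invr_ge0 exprn_ge0 // ltW.
    have -> : n%:R ^+ 3 * r%:R ^+ 6 / x ^+ 6 = (((x / r%:R) ^+ 2 / n%:R) ^+ 3)^-1.
      by field; rewrite !gt_eqF.
    by rewrite lef_pV2 ?posrE ?exprn_gt0 // lerXn2r ?nnegrE // ltW.
  rewrite -mulr_sumr.
  have := sum_inv_max_pow6 R S (@card_mode_eq r') (@card_mode_le r') n7.
  have c0 : 0 <= n%:R ^+ 3 * r%:R ^+ 6 :> R by rewrite mulr_ge0 ?exprn_ge0.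
  move=> /(ler_wpM2l c0) /le_trans; apply.
  have [k nE] : exists k, n = (7 + k)%N by exists (n - 7)%N; rewrite subnKC.
  have -> : (n - 7 = k)%N by rewrite nE addKn.
  have -> : (r ^ n)%:R = r%:R * r%:R ^+ 6 * r%:R ^+ k :> R.
    by rewrite nE -exprS -exprD natrX.
  (* Three powers of n come from the inverse cube, one from the choice of a coordinate, and one
     makes the result O(1/n). *)
  have gk : n%:R ^+ 5 * (3 / 4) ^+ k <= 20 ^+ 5 :> R.
    apply: le_trans (pow5_geometric k); rewrite ler_wpM2r ?exprn_ge0 ?divr_ge0 //.
    by rewrite lerXn2r ?nnegrE // ler_nat nE addnC leq_add2l.
  have S34 : S.*2.+1%:R ^+ k <= (3 / 4) ^+ k * r%:R ^+ k :> R.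
    have S34 : S.*2.+1%:R <= 3 / 4 * r%:R :> R.
      by rewrite mulrAC ler_pdivlMr // -!natrM ler_nat quarter_double.
    have S0 : 0 <= S.*2.+1%:R :> R by [].
    rewrite -exprMn; apply: lerXn2r => //; rewrite nnegrE; exact: le_trans S34.
  have Sr : S%:R <= r%:R :> R by rewrite ler_nat /S leq_div.
  rewrite natrM /K3.
  rewrite [leLHS](_ : _ = n%:R ^+ 4 * r%:R ^+ 6 * (2 * 3 ^+ 6) * (S%:R * S.*2.+1%:R ^+ k));
    last by ring.
  rewrite [leRHS](_ : _ = n%:R ^+ 4 * r%:R ^+ 6 * (2 * 3 ^+ 6) *
     (r%:R * (20 ^+ 5 / n%:R ^+ 5 * r%:R ^+ k))); last by field; rewrite gt_eqF.
  apply: ler_wpM2l; first by rewrite !mulr_ge0 ?exprn_ge0.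
  apply: ler_pM => //; first by rewrite exprn_ge0.
  apply: le_trans S34 _; rewrite ler_wpM2r ?exprn_ge0 // ler_pdivlMr ?exprn_gt0 //.
  by rewrite mulrC.
apply: le_trans (lerD le1 le2) _; rewrite -mulrDr ler_wpM2l //.
have := ler_wpM2l K20 Omn; have := ler_wpM2l K30 Omn.
have : 0 <= (Omega e)%:R^-1 :> R by rewrite invr_ge0.
move: (_%:R^-1) (_%:R^-1) => y z; nra.
Qed.

End TwoTori.

(** * The spread-out torus *)

Section SpreadOut.
Variables (R : realType) (r' n L : nat).
Local Notation r := r'.+2.
Local Notation e := (@spread_out_edge L r n).
Local Notation N := (L.*2.+1).
Hypothesis (L_gt0 : (0 < L)%N) (Nr : (N <= r)%N).
Implicit Types (f : {ffun 'I_n -> 'I_r}) (a : 'I_r) (x y : torus r n).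

Definition ball : {pred 'I_r} := [pred a : 'Z_r | (Zr_dist (0%R : 'Z_r) a <= L)%N].

Lemma Zr_dist_sym (a b : 'Z_r) : Zr_dist a b = Zr_dist b a.
Proof. exact: minnC. Qed.

Lemma Zr_dist0E a : Zr_dist (0%R : 'Z_r) a = minn a (r - a)%N.
Proof.
rewrite /Zr_dist subr0 sub0r minnC /=.
case: (posnP a) => [->|a0]; first by rewrite !min0n.
by rewrite modn_small // -subn_gt0 subKn // ltnW.
Qed.

Lemma Zr_dist0_eq0 a : (Zr_dist (0%R : 'Z_r) a == 0%N) = (a == 0 :> 'Z_r).
Proof.
rewrite Zr_dist0E; apply/eqP/eqP => [H|-> /=]; last by rewrite min0n.
apply: val_inj; move/eqP: H; rewrite -leqn0 geq_min !leqn0 subn_eq0 leqNgt ltn_ord orbF.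
by move/eqP.
Qed.

Lemma spread_out_edge_sym : symmetric e.
Proof.
move=> x y; rewrite /spread_out_edge.
by under eq_bigr do rewrite Zr_dist_sym.
Qed.

Definition in_box x := [forall i, (x 0 i : 'I_r) \in ball].

Lemma spread_out_edge0E x : e 0 x = (x != 0) && in_box x.
Proof.
rewrite /spread_out_edge; congr (_ && _); last first.
  apply/bigmax_leqP/forallP => H i; have := H i; rewrite mxE ?inE //.
  by move=> /(_ isT).
rewrite lt0n; congr (~~ _); apply/eqP/eqP => [H|->]; last first.
  by rewrite big1 // => i _; apply/eqP; rewrite mxE Zr_dist0_eq0.
apply/rowP => i; apply/eqP; rewrite [X in _ == X]mxE -Zr_dist0_eq0.
have := bigop.leq_bigmax (F := fun i => Zr_dist ((0 : torus r n) 0 i) (x 0 i)) i.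
by rewrite H mxE leqn0.
Qed.

(** The representatives at distance at most L form the ranges [0, L] and [r - L, r), disjoint
    because 2L + 1 <= r; nonzero elements are paired as l and r - l. *)
Lemma sum_ball (V : nmodType) (F : nat -> V) :
  \sum_(a in ball) F a = F 0%N + \sum_(l < L) (F l.+1 + F (r - l.+1)%N).
Proof.
rewrite (eq_bigl (fun a : 'I_r => (minn a (r - a) <= L)%N)); last first.
  by move=> a; rewrite !inE Zr_dist0E.
rewrite -(big_mkord (fun b => minn b (r - b) <= L)%N F) /=.
rewrite (big_cat_nat (n := L.+1)) //=; last by lia.
rewrite [X in _ + X](big_cat_nat (n := (r - L)%N)) /=; [|lia|lia].
have -> : \sum_(L.+1 <= b < r - L | (minn b (r - b) <= L)%N) F b = 0.
  by rewrite big_nat_cond big1 // => b; lia.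
rewrite add0r.
have -> : \sum_(0 <= b < L.+1 | (minn b (r - b) <= L)%N) F b = \sum_(0 <= b < L.+1) F b.
  rewrite big_nat_cond [RHS]big_nat_cond; apply: eq_bigl => a.
  by lia.
rewrite big_nat_recl // -addrA big_split /=; congr (_ + (_ + _)); first by rewrite big_mkord.
have -> : \sum_(r - L <= b < r | (minn b (r - b) <= L)%N) F b = \sum_(r - L <= b < r) F b.
  rewrite big_nat_cond [RHS]big_nat_cond; apply: eq_bigl => a.
  by lia.
rewrite big_nat_rev /= -{1}[(r - L)%N]add0n big_addn.
have -> : (r - (r - L) = L)%N by lia.
rewrite big_mkord; apply: eq_bigr => l _; congr F; have := ltn_ord l; lia.
Qed.

Lemma card_ball : #|ball| = N.
Proof.
by rewrite -sum1_card (sum_ball (fun=> 1%N)) sum_nat_const card_ord; lia.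
Qed.

(** The Dirichlet kernel at the angle 2 pi mode / r, that is, the Fourier transform of the indicator
    of [ball]. *)
Definition kernel (j : 'I_r) : R :=
  1 + \sum_(l < L) 2 * cos (2 * (pi / r%:R * (mode j)%:R) * l.+1%:R).

Lemma sum_ball_expi (j : 'I_r) :
  \sum_(a in ball) expi (freq R j * (a : nat)%:R) = (kernel j)%:C.
Proof.
rewrite (sum_ball (fun b => expi (freq R j * b%:R))) mulr0 expi0 /kernel rmorphD rmorph1.
congr (_ + _); rewrite rmorph_sum; apply: eq_bigr => l _.
have lr : (l.+1 <= r)%N by have := ltn_ord l; lia.
rewrite natrB // mulrBr expiD expi_freq_r mul1r.
have -> : 2 * (pi / r%:R * (mode j)%:R) * l.+1%:R = 2 * pi / r%:R * (mode j * l.+1)%:R :> R.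
  by rewrite natrM; ring.
rewrite -cos_freqM /expi cosN sinN.
by apply/eqP; rewrite eq_complex /=; apply/andP; split; apply/eqP; ring.
Qed.

Lemma big_row (V : nmodType) (P : pred (torus r n)) (F : torus r n -> V) :
  \sum_(x | P x) F x =
  \sum_(g : {ffun 'I_n -> 'I_r} | P (\row_i g i)) F (\row_i g i).
Proof.
rewrite (reindex (fun g : {ffun 'I_n -> 'I_r} => \row_i g i : torus r n)) //=.
exists (fun x : torus r n => [ffun i => x 0 i]) => [g _|x _].
  by apply/ffunP => i; rewrite ffunE mxE.
by apply/rowP => i; rewrite mxE ffunE.
Qed.

Lemma in_boxE (g : {ffun 'I_n -> 'I_r}) : in_box (\row_i g i) = (g \in ffun_on ball).
Proof.
by apply/forallP/ffun_onP => H i; have := H i; rewrite mxE.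
Qed.

(** The box is a product of balls, so its transform factors; the detour through [expi] supplies the
    multiplicativity that cosines lack. *)
Lemma sum_box_cos f :
  \sum_(x | in_box x) cos (kdot (dual_point R f) x) = \prod_i kernel (f i).
Proof.
have : \sum_(x | in_box x) expi (kdot (dual_point R f) x) = (\prod_i kernel (f i))%:C.
  transitivity (\prod_i \sum_(a in ball) expi (freq R (f i) * (a : nat)%:R)); last first.
    by rewrite rmorph_prod; apply: eq_bigr => i _; exact: sum_ball_expi.
  rewrite (bigA_distr_big _ (fun i a => expi (freq R (f i) * (a : nat)%:R))) /= big_row.
  apply: eq_big => g; first exact: in_boxE.
  by move=> _; rewrite expi_kdot; apply: eq_bigr => i _; rewrite mxE.
move=> /(congr1 (@complex.Re R)) /= <-.
by rewrite (big_morph (@complex.Re R) (id1 := 0) (op1 := +%R)) //= => -[? ?] [].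
Qed.

Lemma card_box : #|in_box| = (N ^ n)%N.
Proof.
rewrite -sum1_card big_row sum1_card -card_ball -[n in RHS]card_ord -card_ffun_on.
by apply: eq_card => g; rewrite -in_boxE.
Qed.

Lemma spread_out_Omega_le : (Omega e <= N ^ n)%N.
Proof.
rewrite -card_box; apply: subset_leq_card; apply/subsetP => x.
by rewrite inE spread_out_edge0E => /andP[].
Qed.

Lemma spread_out_Omega_gt0 : (0 < n)%N -> (0 < Omega e)%N.
Proof.
move=> n0; rewrite /Omega /degree card_gt0; apply/set0Pn.
exists (unit_vec (Ordinal n0) 1); rewrite inE spread_out_edge0E; apply/andP; split.
  by apply/eqP => /rowP /(_ (Ordinal n0)); rewrite !mxE eqxx.
apply/forallP => i; rewrite mxE !inE Zr_dist0E.
by rewrite geq_min; case: ifP => _; rewrite ?leq0n //; apply/orP; left; exact: L_gt0.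
Qed.

Lemma kernel_sin (j : 'I_r) :
  kernel j * sin (pi / r%:R * (mode j)%:R) = sin (N%:R * (pi / r%:R * (mode j)%:R)).
Proof. exact: dirichlet_kernel. Qed.

Lemma kernel_norm_le (j : 'I_r) : `|kernel j| <= N%:R.
Proof.
apply: le_trans (ler_normD _ _) _; rewrite normr1 -(natr1 L.*2) [leLHS]addrC lerD2r.
apply: le_trans (ler_norm_sum _ _ _) _.
have -> : L.*2%:R = \sum_(l < L) 2 :> R.
  by rewrite sumr_const card_ord -mul2n natrM mulr_natr.
apply: ler_sum => l _; rewrite normrM ger0_norm // ler_piMr //; exact: cos_max.
Qed.

Lemma sum_sqr (m : nat) :
  \sum_(l < m) (l.+1%:R : R) ^+ 2 = m%:R * (m%:R + 1) * (2 * m%:R + 1) / 6.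
Proof.
elim: m => [|m IH]; first by rewrite big_ord0 !mul0r.
rewrite big_ord_recr /= IH -(natr1 m); by move: (m%:R : R) => z; field.
Qed.

(* Below the threshold t = 2/3 the kernel is nonnegative and controlled by the
   quadratic lower bound on 1 - cos; above it, by Jordan's bound on sin. *)
Lemma kernel_gap (j : 'I_r) : (0 < mode j)%N ->
  let t := N%:R * (mode j)%:R / r%:R : R in
  `|kernel j| / N%:R <= 3 / 4 \/
  (t <= 1 /\ `|kernel j| / N%:R <= 1 - t ^+ 2 / 4).
Proof.
move=> j0 t; set s := mode j in t *; set th := pi / r%:R * s%:R : R.
have rR0 : 0 < r%:R :> R by rewrite ltr0n.
have sR0 : 0 < s%:R :> R by rewrite ltr0n.
have sr : (2 * s <= r)%N := mode_le j.
have NR0 : 0 < N%:R :> R by rewrite ltr0n.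
have sin_th : 2 * s%:R <= r%:R * sin th.
  have := @jordan_nat R r (2 * s) isT sr; rewrite natrM.
  suff -> : 2 * s%:R * (pi / 2 / r%:R) = th :> R by [].
  by rewrite /th; move: (r%:R : R) rR0 => q q0; field; rewrite gt_eqF.
have sin0 : 0 < sin th.
  by rewrite -(pmulr_rgt0 _ rR0); apply: lt_le_trans sin_th; rewrite mulr_gt0.
case: (leqP (2 * r) (3 * (N * s))) => tN.
  (* Here t >= 2/3. From [|kernel| sin th <= 1] and [sin th >= 2s/r] follows
     [|kernel|/N <= 1/(2t) <= 3/4]. *)
  left; rewrite ler_pdivrMr // -(ler_pM2r sin0) -[X in _ * X <= _](gtr0_norm sin0) -normrM.
  rewrite kernel_sin; apply: le_trans (sin_max _) _.
  move: tN; rewrite -(ler_nat R) !natrM => tN.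
  rewrite -(ler_pM2l rR0) mulr1 mulrCA.
  apply: (@le_trans _ _ (3 / 4 * N%:R * (2 * s%:R))); first by lra.
  by rewrite ler_wpM2l // mulr_ge0 // divr_ge0.
right.
have Nsr : (N * s <= r)%N by lia.
split; first by rewrite ler_pdivrMr // mul1r -natrM ler_nat.
have k0 : 0 <= kernel j.
  rewrite -(pmulr_lge0 _ sin0) kernel_sin; apply: sin_ge0_pi.
  apply/andP; split; first by rewrite mulr_ge0 // mulr_ge0 // divr_ge0 // pi_ge0.
  have -> : N%:R * (pi / r%:R * s%:R) = pi * (N%:R * s%:R / r%:R) :> R by ring.
  by rewrite ler_piMr ?pi_ge0 // ler_pdivrMr // mul1r -natrM ler_nat.
rewrite ger0_norm // ler_pdivrMr //.
(* Termwise [2 - 2 cos(2 pi s l / r) >= 16 (s l / r)^2], legitimate since t < 2/3 forces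
   [2 s l <= r]. *)
have kle : kernel j <= N%:R - \sum_(l < L) 16 * (s%:R / r%:R) ^+ 2 * l.+1%:R ^+ 2.
  have -> : N%:R = 1 + \sum_(l < L) 2 :> R.
    by rewrite sumr_const card_ord -(natr1 L.*2) addrC -mul2n natrM mulr_natr.
  rewrite -addrA -sumrB lerD2l; apply: ler_sum => l _.
  have l2 : (2 * (s * l.+1) <= r)%N by have := ltn_ord l; nia.
  have := @one_sub_cos_ge R r (s * l.+1) isT l2.
  have -> : 2 * pi / r%:R * (s * l.+1)%:R = 2 * th * l.+1%:R :> R.
    by rewrite natrM /th; ring.
  rewrite natrM -/s -/th; have -> : s%:R * l.+1%:R / r%:R = s%:R / r%:R * l.+1%:R :> R by ring.
  rewrite exprMn -[16 * _ * _]mulrA; move: (_ ^+ 2 * _) (cos _) => p c; lra.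
apply: (le_trans kle); rewrite -mulr_sumr sum_sqr /t.
have -> : N%:R * s%:R / r%:R = N%:R * (s%:R / r%:R) :> R by rewrite mulrA.
have := sqr_ge0 (s%:R / r%:R : R).
rewrite [(N%:R * _) ^+ 2]exprMn; move: ((s%:R / r%:R) ^+ 2) => y y0.
have NL : N%:R = 2 * L%:R + 1 :> R by rewrite -(natr1 L.*2) -mul2n natrM.
have : 1 <= L%:R :> R by rewrite ler1n.
rewrite NL; move: (L%:R : R) => l l1; rewrite -subr_ge0.
(* What remains is [8/3 L(L+1) >= (2L+1)^2 / 4], true for L >= 1. *)
rewrite (_ : _ - _ = y * (2 * l + 1) * (8 / 3 * (l * (l + 1)) - (2 * l + 1) ^+ 2 / 4)); last first.
  by field.
by apply: mulr_ge0; [apply: mulr_ge0 => //; lra | nra].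
Qed.

(** The origin adds [1 - cos 0 = 0], so the sum runs over the whole box and equals [N^n] minus a
    product of kernels. All factors but the i-th are bounded by N, and [Omega <= N^n]. *)
Lemma spread_out_hat_lower f i : (0 < n)%N ->
  1 - `|kernel (f i)| / N%:R <= 1 - hat R e f.
Proof.
move=> n0; have Om0 := spread_out_Omega_gt0 n0; rewrite one_sub_hat //.
have -> : \sum_(x | e 0 x) (1 - cos (kdot (dual_point R f) x)) =
   \sum_(x | in_box x) (1 - cos (kdot (dual_point R f) x)).
  rewrite big_mkcond [RHS]big_mkcond; apply: eq_bigr => x _.
  rewrite spread_out_edge0E; case: eqP => //= ->.
  by rewrite kdot0 cos0 subrr; case: ifP.
rewrite sumrB sumr_const sum_box_cos.
have -> : #|[pred x | in_box x]| = (N ^ n)%N by rewrite -card_box; exact: eq_card.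
have NR0 : 0 < N%:R :> R by rewrite ltr0n.
have Nn0 : 0 < (N ^ n)%:R :> R by rewrite ltr0n expn_gt0.
have le1 : \prod_i kernel (f i) <= (N ^ n)%:R * (`|kernel (f i)| / N%:R).
  apply: le_trans (ler_norm _) _; rewrite normr_prod (bigD1 i) //=.
  rewrite [leRHS]mulrCA ler_wpM2l //.
  rewrite ler_pdivlMr // mulrC natrX -[n in leRHS]card_ord -prodr_const [leRHS](bigD1 i) //=.
  rewrite ler_wpM2l ?(ltW NR0) //.
  by apply: ler_prod => j _; rewrite normr_ge0 kernel_norm_le.
have u1 : `|kernel (f i)| / N%:R <= 1 by rewrite ler_pdivrMr // mul1r kernel_norm_le.
apply: (@le_trans _ _ ((Omega e)%:R^-1 * ((N ^ n)%:R * (1 - `|kernel (f i)| / N%:R)))); last first.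
  by rewrite ler_wpM2l ?invr_ge0 // mulrBr mulr1 lerD2l lerN2.
rewrite mulrA ler_peMl ?subr_ge0 //.
by rewrite mulrC ler_pdivlMr ?ltr0n // mul1r ler_nat spread_out_Omega_le.
Qed.

(** At a coordinate of maximal mode, [kernel_gap] gives either [1 - hat >= 1/4], handled by
    Parseval, or [1 - hat >= t^2/4] with t <= 1, handled by shells. *)
Lemma spread_out_A_cond : (7 <= n)%N ->
  A_cond e ((1 + 4 ^+ 3 + 4 ^+ 3 * (2 * 3 ^+ 6) * n%:R * 3 ^+ (n - 7)) * (Omega e)%:R^-1 : R).
Proof.
move=> n7; have n0 : (0 < n)%N by lia.
set K1 := 4 ^+ 3; set K2 := K1 * _ * _ * _.
have inv_e : translation_invariant e by exact: spread_out_edge_invariant.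
have sym_e := spread_out_edge_sym.
have K10 : 0 <= K1 by exact: exprn_ge0.
have K20 : 0 <= K2 by rewrite /K2 !mulr_ge0 ?exprn_ge0.
have Om0 : 0 < (Omega e)%:R :> R by rewrite ltr0n spread_out_Omega_gt0.
have rR0 : 0 < r%:R :> R by [].
have NR0 : 0 < N%:R :> R by [].
apply: A_cond_real => [x||]; [exact: edge_oppr | lra |].
(* The condition t <= 1 says that the mode is at most r/N. *)
pose S := (r %/ N)%N.
pose P f := (0 < \max_(i < n) mode (f i) <= S)%N.
pose G f : R := K1 * (r%:R / N%:R) ^+ 6 * ((\max_(i < n) mode (f i))%N%:R ^+ 6)^-1.
have G0 f : 0 <= G f by rewrite /G !mulr_ge0 ?invr_ge0 ?exprn_ge0 // divr_ge0.
have cube (u A : R) : 0 < u -> u <= A -> (A ^+ 3)^-1 <= (u ^+ 3)^-1.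
  move=> u0 uA; rewrite lef_pV2 ?posrE ?exprn_gt0 ?(lt_le_trans u0) //.
  by apply: lerXn2r => //; rewrite nnegrE ltW // (lt_le_trans u0).
have le1 : \sum_(f : {ffun 'I_n -> 'I_r} | ~~ [forall i, mode (f i) == 0%N])
      hat R e f ^+ 2 / (1 - hat R e f) ^+ 3 <=
    \sum_f K1 * hat R e f ^+ 2 + \sum_(f | P f) G f.
  rewrite [X in _ <= _ + X]big_mkcond -big_split big_mkcond /=; apply: ler_sum => f _.
  have H0 := sqr_ge0 (hat R e f).
  have rest : 0 <= (if P f then G f else 0) by case: ifP.
  case: ifP => [|_]; last by rewrite addr_ge0 // mulr_ge0.
  rewrite -max_mode_gt0 => m0; have [i iE] := max_modeP f n0.
  have := spread_out_hat_lower f i n0; set u := `|_| / _; set A := 1 - hat R e f => uA.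
  move: m0; rewrite iE => m0.
  case: (kernel_gap m0) => [u34|[t1 ut]].
    apply: (@le_trans _ _ (K1 * hat R e f ^+ 2)); last by rewrite lerDl.
    rewrite mulrC ler_wpM2r //.
    have -> : K1 = (4^-1 ^+ 3)^-1 by rewrite exprVn invrK.
    apply: cube; first by rewrite invr_gt0.
    by apply: le_trans uA; rewrite -/u in u34; lra.
  apply: (@le_trans _ _ (G f)); last first.
    suff -> : P f by rewrite lerDr mulr_ge0.
    rewrite /P -/(max_mode f) iE m0 /= /S leq_divRL //.
    by move: t1; rewrite ler_pdivrMr // mul1r -natrM ler_nat mulnC.
  rewrite /G -/(max_mode f) iE; move: ut; set t := _ / r%:R => ut.
  have t0 : 0 < t by rewrite divr_gt0 // mulr_gt0 // ltr0n.
  apply: (@le_trans _ _ (A ^+ 3)^-1).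
    rewrite ler_piMl ?hat_sqr_le1 // invr_ge0 exprn_ge0 //.
    by apply: le_trans uA; rewrite -/u in ut; have := sqr_ge0 t; have := exprn_gt0 2 t0; lra.
  have -> : K1 * (r%:R / N%:R) ^+ 6 * ((mode (f i))%:R ^+ 6)^-1 = ((t ^+ 2 / 4) ^+ 3)^-1.
    have m0' : 0 < (mode (f i))%:R :> R by rewrite ltr0n.
    rewrite /K1 /t; move: (r%:R : R) (N%:R : R) ((mode (f i))%:R : R) rR0 NR0 m0'.
    by move=> p q m p0 q0 m0'; field; rewrite !gt_eqF.
  by apply: cube; [rewrite divr_gt0 // exprn_gt0 | apply: le_trans uA; rewrite -/u in ut; lra].
apply: (le_trans le1); rewrite -!mulr_sumr parseval; last exact: edge_oppr.
have := sum_inv_max_pow6 R S (@card_mode_eq r') (@card_mode_le r') n7.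
have c0 : 0 <= K1 * (r%:R / N%:R) ^+ 6 :> R by rewrite mulr_ge0 ?exprn_ge0 ?divr_ge0.
move=> /(ler_wpM2l c0) le2.
apply: le_trans (lerD (lexx _) le2) _.
suff le3 : K1 * (r%:R / N%:R) ^+ 6 *
     ((n * S)%:R * (2 * 3 ^+ 6 * S.*2.+1%:R ^+ (n - 7))) <=
     (r ^ n)%:R * (K2 / (Omega e)%:R).
  apply: le_trans (lerD (lexx _) le3) _.
  rewrite mulrCA -mulrDr ler_wpM2l // -mulrDl ler_wpM2r ?invr_ge0 //; lra.
have SN : S%:R <= r%:R / N%:R :> R.
  by rewrite ler_pdivlMr // -natrM ler_nat leq_trunc_div.
have S3 : S.*2.+1%:R <= 3 * (r%:R / N%:R) :> R.
  have : 1 <= r%:R / N%:R :> R by rewrite ler_pdivlMr // mul1r ler_nat.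
  rewrite -(natr1 S.*2) -(mul2n S) natrM; move: SN.
  by move: (r%:R / N%:R) => u; lra.
have Sk : S.*2.+1%:R ^+ (n - 7) <= (3 * (r%:R / N%:R)) ^+ (n - 7) :> R.
  have S0 : 0 <= S.*2.+1%:R :> R by [].
  by apply: lerXn2r => //; rewrite nnegrE; exact: le_trans S3.
have nE : n = (7 + (n - 7))%N by rewrite subnKC.
have u0 : 0 <= r%:R / N%:R :> R by rewrite divr_ge0.
apply: (@le_trans _ _ ((r%:R / N%:R) ^+ n * K2)).
  have -> : (r%:R / N%:R) ^+ n = r%:R / N%:R * (r%:R / N%:R) ^+ 6 * (r%:R / N%:R) ^+ (n - 7) :> R.
    by rewrite -exprS -exprD -nE.
  move: SN Sk u0; rewrite exprMn natrM /K2; move: (r%:R / N%:R) => u SN Sk u0.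
  rewrite [leLHS](_ : _ = K1 * u ^+ 6 * n%:R * (2 * 3 ^+ 6) * (S%:R * S.*2.+1%:R ^+ (n - 7)));
    last by ring.
  rewrite [leRHS](_ : _ = K1 * u ^+ 6 * n%:R * (2 * 3 ^+ 6) * (u * (3 ^+ (n - 7) * u ^+ (n - 7))));
    last by ring.
  apply: ler_wpM2l; first by rewrite !mulr_ge0 ?exprn_ge0.
  by apply: ler_pM => //; exact: exprn_ge0.
(* The shells contribute order [(r/N)^n], and [N^-n <= 1/Omega] turns this into the volume over
   Omega. *)
rewrite [leRHS]mulrCA [leLHS]mulrC ler_wpM2l // expr_div_n natrX ler_wpM2l ?exprn_ge0 //.
by rewrite lef_pV2 ?posrE ?exprn_gt0 // -natrX ler_nat spread_out_Omega_le.
Qed.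

End SpreadOut.

Theorem proposition1p2 (R : realType) :
  (exists a : R, 0 < a /\
     forall r n : nat, (2 <= r)%N -> (7 <= n)%N ->
       A_cond (@nn_edge r n) (a * (Omega (@nn_edge r n))%:R^-1)) /\
  (exists a : R, 0 < a /\
     forall r n : nat, (2 <= r)%N -> (1 <= n)%N ->
       A_cond (@hamming_edge r n) (a * (Omega (@hamming_edge r n))%:R^-1)) /\
  (forall n : nat, (7 <= n)%N ->
     exists a : R, 0 < a /\
       exists L0 : nat, forall L : nat, (L0 <= L)%N ->
         exists r0 : nat, forall r : nat, (r0 <= r)%N -> (2 * L + 1 <= r)%N ->
           A_cond (@spread_out_edge L r n)
             (a * (Omega (@spread_out_edge L r n))%:R^-1)).
Proof.
have pos (x y : R) : 0 <= x -> 0 <= y -> 0 < 1 + x + y by lra.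
have ge0 := (addr_ge0, exprn_ge0, divr_ge0, mulr_ge0, invr_ge0).
split; [|split].
- eexists; split; last by move=> [|[|r]] n // _; exact: nn_A_cond.
  by rewrite -(addrA (1 + _)); apply: pos; rewrite ?ge0.
- eexists; split; last by move=> [|[|r]] n // _; exact: hamming_A_cond.
  by apply: pos; rewrite ?ge0.
move=> n n7; eexists; split; last first.
  (* L >= 1 and 2L + 1 <= r suffice for the bound; the threshold 2 discards r = 0 and r = 1. *)
  exists 1%N => L L0; exists 2%N => -[|[|r]] // _ Lr.
  by apply: (spread_out_A_cond R L0 _ n7); move: Lr; rewrite addn1 mul2n.
by apply: pos; rewrite !ge0.
Qed.
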